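(* Let $A,B,C\in[B(\mathcal H)^n]_1^-$. (i) If $A\overset{H}{\prec}B$ and $B\overset{H}{\prec}C$, then $A\overset{H}{\prec}C$. In this case, we have $$L_{C,A}^*=L_{C,B}^*L_{B,A}^*\quad\text{and}\quad\Theta_{C,A}=\Theta_{C,B}\Theta_{B,A}.$$ (ii) If $A\overset{H}{\prec}B$, then $A\overset{H}{\sim}B$ if and only if $\Theta_{B,A}$ is an invertible multi-analytic operator. In this case, we have $\Theta_{B,A}^{-1}=\Theta_{A,B}$.
   Context: $n$ is a positive integer, $\mathcal H$ is a complex Hilbert space, and $B(\mathcal H)$ is the algebra of bounded linear operators on $\mathcal H$. $[B(\mathcal H)^n]_1^-$ (resp. $[B(\mathcal H)^n]_1$) is the set of $(X_1,\ldots,X_n)\in B(\mathcal H)^n$ with $\|X_1X_1^*+\cdots+X_nX_n^*\|^{1/2}\le 1$ (resp. $<1$). Harnack domination: for $A,B\in[B(\mathcal H)^n]_1^-$, $A\overset{H}{\prec}B$ means that there is $c>0$ with $\mathrm{Re}\,p(A)\le c^2\,\mathrm{Re}\,p(B)$ for every $m\in\mathbb N$ and every noncommutative polynomial with matrix coefficients $p\in\mathbb C[X_1,\ldots,X_n]\otimes M_m$ such that $\mathrm{Re}\,p(X)\ge0$ for all $X\in[B(\mathcal K)^n]_1$, where $\mathcal K$ is an infinite-dimensional Hilbert space ($\mathrm{Re}\,T=\frac12(T+T^* )$). $A\overset{H}{\sim}B$ means $A\overset{H}{\prec}B$ and $B\overset{H}{\prec}A$. $F^2(H_n)=\mathbb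 C1\oplus\bigoplus_{k\ge1}H_n^{\otimes k}$ is the full Fock space of an $n$-dimensional Hilbert space $H_n$ with orthonormal basis $e_1,\ldots,e_n$; $S_i\varphi:=e_i\otimes\varphi$ are the left creation operators. For a row contraction $T\in[B(\mathcal H)^n]_1^-$, $\Delta_{T^*}:=([\delta_{ij}I_{\mathcal H}-T_i^*T_j]_{n\times n})^{1/2}\in B(\mathcal H^{(n)})$ and $\mathcal D_{T^*}:=\overline{\Delta_{T^*}\mathcal H^{(n)}}$, where $\mathcal H^{(n)}$ is the direct sum of $n$ copies of $\mathcal H$. For $i=1,\ldots,n$, $D_{T^*,i}h:=1\otimes\Delta_{T^*}(0,\ldots,0,h,0,\ldots,0)\in F^2(H_n)\otimes\mathcal D_{T^*}$ ($h$ in the $i$-th place). The minimal isometric dilation of $T$ is the $n$-tuple of operators $V_i^T$ on $\mathcal K_T:=\mathcal H\oplus[F^2(H_n)\otimes\mathcal D_{T^*}]$ given by $V_i^T(h\oplus\xi):=T_ih\oplus[D_{T^*,i}h+(S_i\otimes I_{\mathcal D_{T^*}})\xi]$. If $A\overset{H}{\prec}B$, then $L_{B,A}:\mathcal K_B\to\mathcal K_A$ denotes the unique bounded operator with $L_{B,A}|_{\mathcal H}=I_{\mathcal H}$ and $L_{B,A}V_i^B=V_i^AL_{B,A}$, $i=1,\ldots,n$. With respect to the decompositions above, its adjoint $L_{B,A}^*:\mathcal K_A\to\mathcal K_B$ has the form $$L_{B,A}^*=\begin{bmatrix}I_{\mathcal H}&0\\ \Omega_{B,A}&\Theta_{B,A}\end{bmatrix},$$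 where $\Omega_{B,A}:\mathcal H\to F^2(H_n)\otimes\mathcal D_{B^*}$ is bounded and $\Theta_{B,A}:F^2(H_n)\otimes\mathcal D_{A^*}\to F^2(H_n)\otimes\mathcal D_{B^*}$ is a multi-analytic operator, i.e. bounded with $\Theta_{B,A}(S_i\otimes I_{\mathcal D_{A^*}})=(S_i\otimes I_{\mathcal D_{B^*}})\Theta_{B,A}$ for all $i$. This defines $\Omega_{B,A}$ and $\Theta_{B,A}$ (and likewise for the other pairs). *)

(* Defs.v *)
From HB Require Import structures.
From mathcomp Require Import all_boot all_order all_algebra.
From mathcomp Require Import sesquilinear complex finmap.
From mathcomp Require Import mathcomp_extra boolp classical_sets functions reals.
From mathcomp Require Import topology normedtype sequences ring lra.

Set Implicit Arguments.
Unset Strict Implicit.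
Unset Printing Implicit Defensive.

Import Order.TTheory GRing.Theory Num.Theory.
Import numFieldNormedType.Exports.

Local Open Scope ring_scope.
Local Open Scope complex_scope.

(* Inner products are linear in the first variable. *)
Definition sqn_of (R : rcfType) (T : Type) (dot : T -> T -> R[i]) (x : T) : R :=
  complex.Re (dot x x).

Definition hcomplete (R : rcfType) (T : zmodType) (nrm : T -> R) : Prop :=
  forall u : nat -> T,
    (forall e : R, 0 < e -> exists N, forall p q, (N <= p)%N -> (N <= q)%N ->
       nrm (u p - u q) < e) ->
    exists l : T, forall e : R, 0 < e -> exists N, forall p, (N <= p)%N ->
       nrm (u p - l) < e.

HB.mixin Record Lmodule_isHilbert (R : realType) (H : Type)
    of GRing.Lmodule R[i] H := {
  hdot : H -> H -> R[i] ;
  hdot_linearl : forall (z : H) (a : R[i]) (x y : H),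
    hdot (a *: x + y) z = a * hdot x z + hdot y z ;
  hdot_herm : forall x y : H, hdot x y = Num.conj (hdot y x) ;
  hdot_pos : forall x : H, x != 0 -> 0 < hdot x x ;
  hilbert_complete : hcomplete (fun x => Num.sqrt (sqn_of hdot x))
}.

#[short(type="hilbertType")]
HB.structure Definition Hilbert (R : realType) :=
  { H of GRing.Lmodule R[i] H & Lmodule_isHilbert R H }.

Section HilbertDot.
Variables (R : realType) (H : hilbertType R).
Implicit Types x y z : H.

Definition sqn x : R := sqn_of hdot x.
Definition hnorm x : R := Num.sqrt (sqn x).

Lemma hdot_bilinear :
  bilinear_for *%R (Num.conj \; *%R) (@hdot R H).
Proof.
split=> [z a x y|z a x y]; first exact: hdot_linearl.
rewrite /= hdot_herm hdot_linearl rmorphD rmorphM /=.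
by rewrite -hdot_herm -(hdot_herm z y).
Qed.

HB.instance Definition _ := bilinear_isBilinear.Build R[i] H H R[i]
  *%R (Num.conj \; *%R) (@hdot R H) hdot_bilinear.

Lemma hdot_hermitian x y : hdot x y = (-1) ^+ false * Num.conj (hdot y x).
Proof. by rewrite expr0 mul1r -hdot_herm. Qed.

HB.instance Definition _ := isHermitianSesquilinear.Build R[i] H
  false Num.conj (@hdot R H) hdot_hermitian.
HB.instance Definition _ := isDotProduct.Build R[i] H (@hdot R H) (@hdot_pos R H).

End HilbertDot.

Section ComplexParts.
Variable R : realType.
Implicit Types a b : R[i].

Lemma ReD a b : complex.Re (a + b) = complex.Re a + complex.Re b.
Proof. by case: a; case: b. Qed.
Lemma ImD a b : complex.Im (a + b) = complex.Im a + complex.Im b.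
Proof. by case: a; case: b. Qed.
Lemma ReM a b : complex.Re (a * b) =
  complex.Re a * complex.Re b - complex.Im a * complex.Im b.
Proof. by case: a; case: b. Qed.
Lemma ImM a b : complex.Im (a * b) =
  complex.Re a * complex.Im b + complex.Im a * complex.Re b.
Proof. by case: a; case: b. Qed.
Lemma Re_sum (I : Type) (r : seq I) (P : pred I) (F : I -> R[i]) :
  complex.Re (\sum_(i <- r | P i) F i) = \sum_(i <- r | P i) complex.Re (F i).
Proof. exact: (big_morph (@complex.Re R) ReD). Qed.
Lemma Im_sum (I : Type) (r : seq I) (P : pred I) (F : I -> R[i]) :
  complex.Im (\sum_(i <- r | P i) F i) = \sum_(i <- r | P i) complex.Im (F i).
Proof. exact: (big_morph (@complex.Im R) ImD). Qed.
Lemma Re_conj a : complex.Re (Num.conj a) = complex.Re a.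
Proof. by case: a. Qed.
Lemma Im_conj a : complex.Im (Num.conj a) = - complex.Im a.
Proof. by case: a. Qed.
Lemma complex_eq a b :
  complex.Re a = complex.Re b -> complex.Im a = complex.Im b -> a = b.
Proof. by case: a => ? ?; case: b => ? ? /= -> ->. Qed.

End ComplexParts.

Lemma sqrt_lt (R : realType) (a e : R) : 0 < e -> (Num.sqrt a < e) = (a < e ^+ 2).
Proof.
move=> e0; rewrite -{1}(ger0_norm (ltW e0)) -sqrtr_sqr ltr_sqrt //.
by rewrite exprn_gt0.
Qed.

Lemma hcomplete_sqrt (R : realType) (T : zmodType) (q : T -> R) :
  hcomplete q -> hcomplete (fun x => Num.sqrt (q x)).
Proof.
move=> cq u cu; have [|l lP] := cq u.
  move=> e e0; have se0 : 0 < Num.sqrt e by rewrite sqrtr_gt0.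
  have [N NP] := cu _ se0; exists N => p q' pN qN.
  by have := NP p q' pN qN; rewrite sqrt_lt // sqr_sqrtr // ltW.
exists l => e e0; have [N NP] := lP _ (exprn_gt0 2 e0); exists N => p pN.
by rewrite sqrt_lt // NP.
Qed.

Section HilbertTheory.
Variables (R : realType) (H : hilbertType R).
Implicit Types x y z : H.

Lemma hdotDl x y z : hdot (x + y) z = hdot x z + hdot y z.
Proof. exact: linearDl. Qed.
Lemma hdotDr x y z : hdot x (y + z) = hdot x y + hdot x z.
Proof. exact: linearDr. Qed.
Lemma hdotZl (a : R[i]) x y : hdot (a *: x) y = a * hdot x y.
Proof. by rewrite linearZl_LR. Qed.
Lemma hdotZr (a : R[i]) x y : hdot x (a *: y) = Num.conj a * hdot x y.
Proof. by rewrite hdot_herm hdotZl rmorphM /= -hdot_herm. Qed.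
Lemma hdot0l x : hdot 0 x = 0.
Proof. exact: linear0l. Qed.

Lemma hdotxx_ge0 x : 0 <= hdot x x.
Proof. by have [->|/hdot_pos/ltW//] := eqVneq x 0; rewrite hdot0l. Qed.

Lemma hdotxx x : hdot x x = (sqn x)%:C.
Proof.
by apply: complex_eq => //=; have := hdotxx_ge0 x; rewrite lecE => /andP[/eqP].
Qed.

Lemma sqn_ge0 x : 0 <= sqn x.
Proof. by have := hdotxx_ge0 x; rewrite lecE => /andP[]. Qed.

Lemma sqn0 : sqn (0 : H) = 0.
Proof. by rewrite /sqn /sqn_of hdot0l. Qed.

Lemma sqn_gt0 x : x != 0 -> 0 < sqn x.
Proof. by move=> /hdot_pos; rewrite hdotxx ltcE => /andP[]. Qed.

Lemma sqnD x y : sqn (x + y) = sqn x + sqn y + 2 * complex.Re (hdot x y).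
Proof.
rewrite /sqn /sqn_of hdotDl !hdotDr !ReD (hdot_herm y x) Re_conj.
ring.
Qed.

Lemma sqnZ (a : R[i]) x :
  sqn (a *: x) = (complex.Re a ^+ 2 + complex.Im a ^+ 2) * sqn x.
Proof.
rewrite {1}/sqn /sqn_of hdotZl hdotZr hdotxx !ReM !ImM Re_conj Im_conj /=.
by ring.
Qed.

Lemma sqnN x : sqn (- x) = sqn x.
Proof. by rewrite -scaleN1r sqnZ /=; ring. Qed.

Lemma sqn_subC x y : sqn (x - y) = sqn (y - x).
Proof. by rewrite -sqnN opprB. Qed.

Lemma sqnD_le x y : sqn (x + y) <= 2 * sqn x + 2 * sqn y.
Proof.
have := sqn_ge0 (x - y); rewrite !sqnD sqnN -scaleN1r hdotZr ReM Re_conj Im_conj /=.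
by lra.
Qed.

Lemma Re_hdot_le x y : `|complex.Re (hdot x y)| <= sqn x + sqn y.
Proof.
have := sqn_ge0 (x - y); have := sqn_ge0 (x + y).
have := sqn_ge0 x; have := sqn_ge0 y.
rewrite !sqnD sqnN -scaleN1r hdotZr ReM Re_conj Im_conj ler_norml /=.
by lra.
Qed.

Lemma Im_hdot_le x y : `|complex.Im (hdot x y)| <= sqn x + sqn y.
Proof.
have -> : complex.Im (hdot x y) = - complex.Re (hdot ((0 +i* 1) *: x) y).
  by rewrite hdotZl ReM /=; ring.
rewrite normrN; apply: (le_trans (Re_hdot_le _ _)).
by rewrite sqnZ /=; lra.
Qed.

Lemma sqn_cauchy_complete : hcomplete (@sqn R H).
Proof.
move=> u cu; have [|l lP] := @hilbert_complete R H u.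
  move=> e e0; have [N NP] := cu _ (exprn_gt0 2 e0); exists N => p q pN qN.
  by rewrite sqrt_lt // NP.
exists l => e e0; have se0 : 0 < Num.sqrt e by rewrite sqrtr_gt0.
have [N NP] := lP _ se0; exists N => p pN.
by have := NP p pN; rewrite sqrt_lt // sqr_sqrtr // ltW.
Qed.

Lemma hnorm_ge0 x : 0 <= hnorm x.
Proof. exact: sqrtr_ge0. Qed.

Lemma sqr_hnorm x : hnorm x ^+ 2 = sqn x.
Proof. by rewrite sqr_sqrtr // sqn_ge0. Qed.

End HilbertTheory.

Section Bounded.
Variables (R : realType) (H K : hilbertType R).

Definition bounded_linear (f : H -> K) : Prop :=
  linear f /\ exists M : R, forall x, hnorm (f x) <= M * hnorm x.

Definition bop_pred : pred (H -> K) := fun f => `[< bounded_linear f >].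

Record bop := Bop { bop_val :> H -> K ; _ : bop_val \in bop_pred }.

HB.instance Definition _ := [isSub for bop_val].
HB.instance Definition _ := [Choice of bop by <:].

Lemma bounded_linearP (f : H -> K) : bounded_linear f <->
  linear f /\ exists2 M : R, 0 <= M & forall x, sqn (f x) <= M * sqn x.
Proof.
split=> [[lf [M fM]]|[lf [M M0 fM]]]; split=> //.
  exists (M ^+ 2); first exact: sqr_ge0.
  move=> x; rewrite -!sqr_hnorm -exprMn; apply: lerXn2r; rewrite ?nnegrE.
  - exact: hnorm_ge0.
  - exact: le_trans (hnorm_ge0 _) (fM x).
  - exact: fM.
exists (Num.sqrt M) => x; rewrite /hnorm -sqrtrM //.
by apply: ler_wsqrtr.
Qed.

Lemma bop_submod : submod_closed bop_pred.
Proof.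
split=> [|a f g].
  apply/asboolP; split=> [b x y|]; first by rewrite scaler0 addr0.
  by exists 0 => x; rewrite mul0r /hnorm sqn0 sqrtr0.
move=> /asboolP/bounded_linearP[lf [M M0 fM]].
move=> /asboolP/bounded_linearP[lg [N N0 gN]].
apply/asboolP/bounded_linearP; split=> [b x y|].
  rewrite /= !fctE lf lg !scalerDr !scalerA (mulrC b a).
  by rewrite -!addrA; congr (_ + _); rewrite addrCA.
set c := complex.Re a ^+ 2 + complex.Im a ^+ 2.
have c0 : 0 <= c by rewrite addr_ge0 ?sqr_ge0.
exists (2 * (c * M) + 2 * N); first by rewrite addr_ge0 ?mulr_ge0.
move=> x; apply: le_trans (sqnD_le _ _) _; rewrite sqnZ -/c [leRHS]mulrDl.
apply: lerD; rewrite -[leRHS]mulrA ler_wpM2l // -mulrA.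
by apply: ler_wpM2l.
Qed.

HB.instance Definition _ := GRing.isSubmodClosed.Build R[i] (H -> K) bop_pred
  (GRing.submod_closed_semi bop_submod).
HB.instance Definition _ := [SubChoice_isSubLmodule of bop by <:].

Lemma bopP (T : bop) : bounded_linear T.
Proof. by case: T => f /= /asboolP. Qed.

HB.instance Definition _ (T : bop) :=
  GRing.isLinear.Build R[i] H K _ (bop_val T) (bopP T).1.

Definition mkbop (f : H -> K) (fP : bounded_linear f) : bop :=
  @Bop f (introT (asboolP _) fP).

Lemma bop_ext (S T : bop) : S =1 T -> S = T.
Proof. by move=> ST; apply: val_inj; apply: funext. Qed.

Lemma bop_addE (S T : bop) x : (S + T) x = S x + T x.
Proof. by []. Qed.
Lemma bop_scaleE (a : R[i]) (S : bop) x : (a *: S) x = a *: S x.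
Proof. by []. Qed.

Definition opnorm (T : bop) : R := sup [set hnorm (T x) | x in [set x | hnorm x <= 1]].

End Bounded.

Lemma bop_sqnP (R : realType) (H K : hilbertType R) (T : bop H K) :
  exists2 M : R, 0 <= M & forall x, sqn (T x) <= M * sqn x.
Proof. by have /bounded_linearP[] := bopP T. Qed.

Section Compose.
Variables (R : realType) (H K L : hilbertType R).

Lemma bid_subproof : bounded_linear (fun x : H => x).
Proof. by split=> //; exists 1 => x; rewrite mul1r. Qed.
Definition bid : bop H H := mkbop bid_subproof.

Lemma bcomp_subproof (S : bop K L) (T : bop H K) :
  bounded_linear (fun x => S (T x)).
Proof.
apply/bounded_linearP; split=> [a x y|]; first by rewrite !linearP.
have [M M0 SM] := bop_sqnP S; have [N N0 TN] := bop_sqnP T.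
exists (M * N) => [|x]; first exact: mulr_ge0.
by apply: le_trans (SM _) _; rewrite -mulrA ler_wpM2l.
Qed.
Definition bcomp (S : bop K L) (T : bop H K) : bop H L := mkbop (bcomp_subproof S T).

End Compose.

Section DirectSum.
Variables (R : realType) (H K : hilbertType R).

Definition pair_dot (x y : H * K) : R[i] := hdot x.1 y.1 + hdot x.2 y.2.

Lemma sqn_pair x : sqn_of pair_dot x = sqn x.1 + sqn x.2.
Proof. by rewrite /sqn_of /pair_dot ReD. Qed.

Lemma pair_dot_linearl z (a : R[i]) x y :
  pair_dot (a *: x + y) z = a * pair_dot x z + pair_dot y z.
Proof. by rewrite /pair_dot !hdot_linearl; ring. Qed.

Lemma pair_dot_herm x y : pair_dot x y = Num.conj (pair_dot y x).
Proof. by rewrite /pair_dot rmorphD /= -!hdot_herm. Qed.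

Lemma pair_dot_pos x : x != 0 -> 0 < pair_dot x x.
Proof.
case: x => x y; rewrite xpair_eqE negb_and => xy; rewrite /pair_dot /=.
case/orP: xy => [/hdot_pos x0|/hdot_pos y0].
  by rewrite ltr_wpDr // hdotxx_ge0.
by rewrite ltr_wpDl // hdotxx_ge0.
Qed.

Lemma pair_complete : hcomplete (sqn_of pair_dot).
Proof.
move=> u cu; have [|l lP] := @sqn_cauchy_complete R H (fun k => (u k).1).
  move=> e e0; have [N NP] := cu e e0; exists N => p q pN qN.
  apply: le_lt_trans (NP p q pN qN); rewrite sqn_pair.
  by rewrite lerDl sqn_ge0.
have [|m mP] := @sqn_cauchy_complete R K (fun k => (u k).2).
  move=> e e0; have [N NP] := cu e e0; exists N => p q pN qN.
  apply: le_lt_trans (NP p q pN qN); rewrite sqn_pair.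
  by rewrite lerDr sqn_ge0.
exists (l, m) => e e0.
have [N NP] := lP _ (divr_gt0 e0 (ltr0n _ 2)).
have [M MP] := mP _ (divr_gt0 e0 (ltr0n _ 2)).
exists (maxn N M) => p; rewrite geq_max => /andP[pN pM].
rewrite sqn_pair /=; have := NP p pN; have := MP p pM; lra.
Qed.

HB.instance Definition _ := Lmodule_isHilbert.Build R (H * K)%type
  pair_dot_linearl pair_dot_herm pair_dot_pos (hcomplete_sqrt pair_complete).

End DirectSum.

Section Power.
Variables (R : realType) (I : finType) (H : hilbertType R).
Implicit Types f g : {ffun I -> H}.

Definition ffun_dot f g : R[i] := \sum_i hdot (f i) (g i).

Lemma sqn_ffun f : sqn_of ffun_dot f = \sum_i sqn (f i).
Proof. by rewrite /sqn_of /ffun_dot Re_sum. Qed.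

Lemma ffun_dot_linearl g (a : R[i]) f f' :
  ffun_dot (a *: f + f') g = a * ffun_dot f g + ffun_dot f' g.
Proof.
rewrite /ffun_dot mulr_sumr -big_split /=; apply: eq_bigr => i _.
by rewrite !ffunE hdot_linearl.
Qed.

Lemma ffun_dot_herm f g : ffun_dot f g = Num.conj (ffun_dot g f).
Proof. by rewrite /ffun_dot rmorph_sum /=; apply: eq_bigr => i _; apply: hdot_herm. Qed.

Lemma ffun_dot_pos f : f != 0 -> 0 < ffun_dot f f.
Proof.
move=> f0; have [i fi] : exists i, f i != 0.
  apply/existsP; apply: contra_neqT f0; rewrite negb_exists => /forallP f0.
  by apply/ffunP => i; rewrite ffunE; apply/eqP; move: (f0 i); rewrite negbK.
rewrite /ffun_dot (bigD1 i) //= ltr_wpDr ?hdot_pos // sumr_ge0 // => j _.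
exact: hdotxx_ge0.
Qed.

Lemma ffun_complete : hcomplete (sqn_of ffun_dot).
Proof.
move=> u cu.
have cui i : exists l : H, forall e : R, 0 < e -> exists N, forall p, (N <= p)%N ->
    sqn (u p i - l) < e.
  apply: (@sqn_cauchy_complete R H (fun k => u k i)) => e e0.
  have [N NP] := cu e e0; exists N => p q pN qN.
  apply: le_lt_trans (NP p q pN qN); rewrite sqn_ffun (bigD1 i) //= !ffunE.
  by rewrite lerDl sumr_ge0 // => j _; apply: sqn_ge0.
have [l lP] := boolp.choice cui.
exists [ffun i => l i] => e e0.
have e'0 : 0 < e / #|I|.+1%:R by rewrite divr_gt0 ?ltr0Sn.
have [N NP] := boolp.choice (fun i => lP i _ e'0).
exists (\max_i N i) => p pN; rewrite sqn_ffun.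
apply: (@le_lt_trans _ _ (\sum_(i : I) e / #|I|.+1%:R)).
  apply: ler_sum => i _; rewrite !ffunE; apply/ltW/NP.
  by apply: leq_trans pN; apply: leq_bigmax.
rewrite sumr_const -[_ *+ #|I|]mulr_natr mulrAC ltr_pdivrMr ?ltr0Sn //.
by rewrite ltr_pM2l // ltr_nat.
Qed.

HB.instance Definition _ := Lmodule_isHilbert.Build R {ffun I -> H}
  ffun_dot_linearl ffun_dot_herm ffun_dot_pos (hcomplete_sqrt ffun_complete).

End Power.

Section ClosedRange.
Variables (R : realType) (H K : hilbertType R) (S : bop H K).

Definition clran_pred : pred K :=
  fun y => `[< forall e : R, 0 < e -> exists x, hnorm (y - S x) < e >].

Record clran := ClRan { clran_val :> K ; _ : clran_val \in clran_pred }.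

HB.instance Definition _ := [isSub for clran_val].
HB.instance Definition _ := [Choice of clran by <:].

Lemma clran_predP y : y \in clran_pred <->
  forall e : R, 0 < e -> exists x, sqn (y - S x) < e.
Proof.
split=> [/asboolP yP e e0|yP].
  have se0 : 0 < Num.sqrt e by rewrite sqrtr_gt0.
  have [x xP] := yP _ se0; exists x.
  by move: xP; rewrite /hnorm sqrt_lt // sqr_sqrtr // ltW.
apply/asboolP => e e0; have [x xP] := yP _ (exprn_gt0 2 e0); exists x.
by rewrite /hnorm sqrt_lt.
Qed.

Lemma clran_submod : submod_closed clran_pred.
Proof.
split=> [|a y z /clran_predP yP /clran_predP zP]; apply/clran_predP => e e0.
  by exists 0; rewrite linear0 subr0 sqn0.
set c := complex.Re a ^+ 2 + complex.Im a ^+ 2.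
have c0 : 0 <= c by rewrite addr_ge0 ?sqr_ge0.
have d0 : 0 < e / (4 * (c + 1)) by rewrite divr_gt0 // mulr_gt0 // ltr_wpDl.
have [x xP] := yP _ d0.
have [x' x'P] := zP _ (divr_gt0 e0 (ltr0n _ 4)).
exists (a *: x + x'); rewrite linearP.
have -> : a *: y + z - (a *: S x + S x') = a *: (y - S x) + (z - S x').
  by rewrite scalerBr opprD addrACA.
apply: le_lt_trans (sqnD_le _ _) _; rewrite sqnZ -/c.
have cx : c * sqn (y - S x) <= e / 4.
  apply: (@le_trans _ _ ((c + 1) * (e / (4 * (c + 1))))).
    apply: ler_pM => //; [exact: sqn_ge0|by rewrite lerDl|exact: ltW].
  have c1 : c + 1 != 0 by rewrite gt_eqF // ltr_wpDl.
  by rewrite le_eqVlt; apply/orP; left; apply/eqP; field.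
lra.
Qed.

HB.instance Definition _ := GRing.isSubmodClosed.Build R[i] K clran_pred
  (GRing.submod_closed_semi clran_submod).
HB.instance Definition _ := [SubChoice_isSubLmodule of clran by <:].

Definition clran_dot (x y : clran) : R[i] := hdot (clran_val x) (clran_val y).

Lemma clran_dot_linearl z (a : R[i]) x y :
  clran_dot (a *: x + y) z = a * clran_dot x z + clran_dot y z.
Proof. by rewrite /clran_dot -hdot_linearl. Qed.

Lemma clran_dot_herm x y : clran_dot x y = Num.conj (clran_dot y x).
Proof. exact: hdot_herm. Qed.

Lemma clran_dot_pos x : x != 0 -> 0 < clran_dot x x.
Proof. by move=> x0; apply: hdot_pos; rewrite -(raddf0 (val : clran -> K)) (inj_eq val_inj). Qed.

Lemma clran_complete : hcomplete (sqn_of clran_dot).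
Proof.
move=> u cu; have [l lP] := @sqn_cauchy_complete R K (fun k => clran_val (u k)) cu.
suff lS : l \in clran_pred by exists (ClRan lS).
apply/clran_predP => e e0; have [N NP] := lP _ (divr_gt0 e0 (ltr0n _ 4)).
have := NP N (leqnn N); case: (u N) => y /= /clran_predP yP yl.
have [x xP] := yP _ (divr_gt0 e0 (ltr0n _ 4)); exists x.
have -> : l - S x = (l - y) + (y - S x) by rewrite addrA subrK.
apply: le_lt_trans (sqnD_le _ _) _; rewrite (sqn_subC l); lra.
Qed.

HB.instance Definition _ := Lmodule_isHilbert.Build R clran
  clran_dot_linearl clran_dot_herm clran_dot_pos (hcomplete_sqrt clran_complete).

Lemma clran_range x : S x \in clran_pred.
Proof. by apply/clran_predP => e e0; exists x; rewrite subrr sqn0. Qed.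

Definition to_clran (x : H) : clran := ClRan (clran_range x).

End ClosedRange.

(* [fock n D] is F^2(H_n) (x) D.  An element is given by its coefficients along
   the orthonormal basis e_w = e_(i_1) (x) ... (x) e_(i_k) of F^2(H_n), where
   w = i_1 ... i_k ranges over the words in the letters 'I_n and the empty word
   stands for 1, that is, xi = \sum_w e_w (x) xi w with
   \sum_w ||xi w||^2 < oo; sums over words are taken degree by degree. *)
Section Fock.
Variables (R : realType) (n : nat) (D : hilbertType R).
Local Notation word := (seq 'I_n).

Definition degree_dot (xi eta : word -> D) (k : nat) : R[i] :=
  \sum_(w : k.-tuple 'I_n) hdot (xi w) (eta w).

Definition fock_pred : pred (word -> D) := fun xi =>
  `[< exists M : R, forall k,
        \sum_(0 <= j < k) \sum_(w : j.-tuple 'I_n) hnorm (xi w) ^+ 2 <= M >].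

Record fock := Fock { fock_val :> word -> D ; _ : fock_val \in fock_pred }.

HB.instance Definition _ := [isSub for fock_val].
HB.instance Definition _ := [Choice of fock by <:].

Definition degree_sqn (xi : word -> D) (k : nat) : R :=
  \sum_(w : k.-tuple 'I_n) sqn (xi w).

Lemma fock_predP xi : xi \in fock_pred <->
  exists M, forall k, series (degree_sqn xi) k <= M.
Proof.
have E k : \sum_(0 <= j < k) \sum_(w : j.-tuple 'I_n) hnorm (xi w) ^+ 2
    = series (degree_sqn xi) k.
  by apply: eq_bigr => j _; apply: eq_bigr => w _; rewrite sqr_hnorm.
by split=> [/asboolP|] [M MP]; [|apply/asboolP]; exists M => k; have := MP k; rewrite E.
Qed.

Lemma degree_sqn_ge0 xi k : 0 <= degree_sqn xi k.
Proof. by apply: sumr_ge0 => w _; apply: sqn_ge0. Qed.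

Lemma degree_sqnD xi eta k :
  degree_sqn (xi + eta) k <= 2 * degree_sqn xi k + 2 * degree_sqn eta k.
Proof.
rewrite /degree_sqn !mulr_sumr -big_split /=; apply: ler_sum => w _.
exact: sqnD_le.
Qed.

Lemma series_sqnD xi eta k : series (degree_sqn (xi + eta)) k
  <= 2 * series (degree_sqn xi) k + 2 * series (degree_sqn eta) k.
Proof.
rewrite /series /= !mulr_sumr -big_split /=; apply: ler_sum => j _.
exact: degree_sqnD.
Qed.

Lemma series_sqnZ (a : R[i]) xi k : series (degree_sqn (a *: xi)) k
  = (complex.Re a ^+ 2 + complex.Im a ^+ 2) * series (degree_sqn xi) k.
Proof.
rewrite /series /= mulr_sumr; apply: eq_bigr => j _.
by rewrite mulr_sumr; apply: eq_bigr => w _; apply: sqnZ.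
Qed.

Lemma fock_submod : submod_closed fock_pred.
Proof.
split=> [|a x y /fock_predP[M xM] /fock_predP[N yN]]; apply/fock_predP.
  exists 0 => k; rewrite /series /= big1 // => j _; apply: big1 => w _.
  exact: sqn0.
set c := complex.Re a ^+ 2 + complex.Im a ^+ 2.
have c0 : 0 <= c by rewrite addr_ge0 ?sqr_ge0.
exists (2 * (c * M) + 2 * N) => k; apply: le_trans (series_sqnD _ _ _) _.
rewrite series_sqnZ -/c; apply: lerD; rewrite ler_wpM2l //.
exact: ler_wpM2l.
Qed.

HB.instance Definition _ := GRing.isSubmodClosed.Build R[i] (word -> D) fock_pred
  (GRing.submod_closed_semi fock_submod).
HB.instance Definition _ := [SubChoice_isSubLmodule of fock by <:].

Implicit Types x y z : fock.

(* <x, y> = \sum_w <x w, y w>, an absolutely convergent sum. *)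
Definition fock_dot x y : R[i] :=
  limn (series (fun k => complex.Re (degree_dot x y k)))
    +i* limn (series (fun k => complex.Im (degree_dot x y k))).

Lemma fock_bounded x : exists M, forall k, series (degree_sqn x) k <= M.
Proof. by case: x => xi /= /fock_predP. Qed.

Lemma abs_summable (f : nat -> R) x y :
  (forall k, `|f k| <= degree_sqn x k + degree_sqn y k) -> cvgn (series f).
Proof.
move=> fxy; have [M xM] := fock_bounded x; have [N yN] := fock_bounded y.
apply: normed_cvg; apply: nondecreasing_is_cvgn.
  by apply: nondecreasing_series => k _ _; apply: normr_ge0.
exists (M + N) => _ [k _ <-]; apply: le_trans (lerD (xM k) (yN k)).
by rewrite /series /= -big_split /=; apply: ler_sum => j _; apply: fxy.
Qed.

Lemma cvg_Re_dot x y : cvgn (series (fun k => complex.Re (degree_dot x y k))).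
Proof.
apply: (@abs_summable _ x y) => k; rewrite /= /degree_dot Re_sum.
apply: le_trans (ler_norm_sum _ _ _) _; rewrite -big_split /=.
by apply: ler_sum => w _; apply: Re_hdot_le.
Qed.

Lemma cvg_Im_dot x y : cvgn (series (fun k => complex.Im (degree_dot x y k))).
Proof.
apply: (@abs_summable _ x y) => k; rewrite /= /degree_dot Im_sum.
apply: le_trans (ler_norm_sum _ _ _) _; rewrite -big_split /=.
by apply: ler_sum => w _; apply: Im_hdot_le.
Qed.

Lemma degree_dot_linearl z (a : R[i]) x y k :
  degree_dot (a *: x + y) z k = a * degree_dot x z k + degree_dot y z k.
Proof.
rewrite /degree_dot mulr_sumr -big_split /=; apply: eq_bigr => w _.
exact: hdot_linearl.
Qed.

Lemma limn_series_comb (s t : R) (f g h : nat -> R) :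
  cvgn (series f) -> cvgn (series g) -> cvgn (series h) ->
  limn (series (fun k => s * f k + t * g k + h k)) =
  s * limn (series f) + t * limn (series g) + limn (series h).
Proof.
move=> cf cg ch; apply/cvg_lim => //.
have -> : series (fun k => s * f k + t * g k + h k) =
    (fun k => s * series f k + t * series g k + series h k).
  by apply: funext => k; rewrite /series /= !mulr_sumr -!big_split.
by apply: cvgD => //; apply: cvgD; apply: cvgM => //; apply: cvg_cst.
Qed.

Lemma fock_dot_linearl z (a : R[i]) x y :
  fock_dot (a *: x + y) z = a * fock_dot x z + fock_dot y z.
Proof.
apply: complex_eq; rewrite ?ReD ?ImD ?ReM ?ImM /fock_dot /=.
  rewrite -mulNr.
  apply: etrans (@limn_series_comb _ _ _ _ _ (@cvg_Re_dot x z) (@cvg_Im_dot x z)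
    (@cvg_Re_dot y z)).
  congr (limn (series _)); apply: funext => k.
  by rewrite degree_dot_linearl ReD ReM mulNr.
apply: etrans (@limn_series_comb _ _ _ _ _ (@cvg_Im_dot x z) (@cvg_Re_dot x z)
  (@cvg_Im_dot y z)).
congr (limn (series _)); apply: funext => k.
by rewrite degree_dot_linearl ImD ImM.
Qed.

Lemma degree_dot_herm x y k : degree_dot x y k = Num.conj (degree_dot y x k).
Proof. by rewrite /degree_dot rmorph_sum /=; apply: eq_bigr => w _; apply: hdot_herm. Qed.

Lemma fock_dot_herm x y : fock_dot x y = Num.conj (fock_dot y x).
Proof.
apply: complex_eq; rewrite ?Re_conj ?Im_conj /fock_dot /=.
  congr (limn (series _)); apply: funext => k /=.
  by rewrite degree_dot_herm Re_conj.
rewrite -limN; last exact: cvg_Im_dot.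
congr (limn _); apply: funext => k; rewrite -[RHS]/(- series _ k) /series /= -sumrN.
by apply: eq_bigr => j _; rewrite degree_dot_herm Im_conj.
Qed.

Lemma fock_sqnE x : sqn_of fock_dot x = limn (series (degree_sqn x)).
Proof.
rewrite /sqn_of /fock_dot /=; congr (limn (series _)); apply: funext => k /=.
by rewrite /degree_dot Re_sum.
Qed.

Lemma Im_fock_dotxx x : complex.Im (fock_dot x x) = 0.
Proof. by have /(congr1 (@complex.Im R)) := fock_dot_herm x x; rewrite Im_conj; lra. Qed.

Lemma cvg_sqn x : cvgn (series (degree_sqn x)).
Proof.
have -> : degree_sqn x = (fun k => complex.Re (degree_dot x x k)).
  by apply: funext => k; rewrite /degree_dot Re_sum.
exact: cvg_Re_dot.
Qed.

Lemma series_sqn_le x k : series (degree_sqn x) k <= sqn_of fock_dot x.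
Proof.
rewrite fock_sqnE; apply: nondecreasing_cvgn_le; last exact: cvg_sqn.
by apply: nondecreasing_series => j _ _; apply: degree_sqn_ge0.
Qed.

Lemma fock_sqn_le x M : (forall k, series (degree_sqn x) k <= M) ->
  sqn_of fock_dot x <= M.
Proof.
move=> xM; rewrite fock_sqnE; apply: limr_le; first exact: cvg_sqn.
exact: nearW.
Qed.

Lemma coef_sqn_le x (w : word) : sqn (x w) <= sqn_of fock_dot x.
Proof.
apply: le_trans (series_sqn_le x (size w).+1).
rewrite /series /= big_nat_recr //= /degree_sqn.
rewrite (bigD1 (in_tuple w)) //= ler_wpDl //.
  by apply: sumr_ge0 => j _; apply: degree_sqn_ge0.
by rewrite lerDl; apply: sumr_ge0 => j _; apply: sqn_ge0.
Qed.

Lemma fock_dot_pos x : x != 0 -> 0 < fock_dot x x.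
Proof.
move=> x0; have [w xw] : exists w, x w != 0.
  apply: contrapT => /forallNP xw; move/eqP: x0; apply; apply: val_inj.
  by apply: funext => w; apply/eqP; move: (xw w) => /negP; rewrite negbK.
rewrite ltcE Im_fock_dotxx eqxx /=.
exact: lt_le_trans (sqn_gt0 xw) (coef_sqn_le x w).
Qed.

Lemma fock_complete : hcomplete (sqn_of fock_dot).
Proof.
move=> u cu.
have cuw (w : word) : exists l : D, forall e : R, 0 < e ->
    exists N, forall p, (N <= p)%N -> sqn (u p w - l) < e.
  apply: (@sqn_cauchy_complete R D (fun k => u k w)) => e e0.
  have [N NP] := cu e e0; exists N => p q pN qN.
  exact: le_lt_trans (coef_sqn_le (u p - u q) w) (NP p q pN qN).
have [l lP] := boolp.choice cuw.
have ul (e : R) : 0 < e -> exists N, forall p, (N <= p)%N -> forall k,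
    series (degree_sqn (fock_val (u p) - l)) k <= e.
  move=> e0; have [N NP] := cu _ (divr_gt0 e0 (ltr0n _ 4)).
  exists N => p pN k.
  suff [q qN ql] : exists2 q, (N <= q)%N &
      series (degree_sqn (fock_val (u q) - l)) k <= e / 4.
    have -> : fock_val (u p) - l =
        (fock_val (u p) - fock_val (u q)) + (fock_val (u q) - l).
      by rewrite addrA subrK.
    apply: le_trans (series_sqnD _ _ _) _.
    have := series_sqn_le (u p - u q) k; have := NP p q pN qN.
    set A := series _ k; set B := series _ k in ql *.
    rewrite -/A; lra.
  pose m := (\sum_(j < k) #|{: j.-tuple 'I_n}|)%N.
  have d0 : 0 < e / 4 / m.+1%:R by rewrite !divr_gt0 ?ltr0Sn.
  have [Q QP] := boolp.choice (fun w => lP w _ d0).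
  exists (maxn N (\max_(j < k) \max_(w : j.-tuple 'I_n) Q w)); first exact: leq_maxl.
  rewrite /series /= big_mkord /degree_sqn.
  apply: (@le_trans _ _ (\sum_(j < k) \sum_(w : j.-tuple 'I_n) e / 4 / m.+1%:R)).
    apply: ler_sum => j _; apply: ler_sum => w _; apply/ltW/QP.
    apply: leq_trans (leq_maxr _ _).
    by apply: leq_trans (leq_bigmax j); apply: (leq_bigmax (F := fun w : j.-tuple _ => Q w)).
  under eq_bigr do rewrite sumr_const.
  rewrite sumrMnr -/m -[_ *+ m]mulr_natr mulrAC ler_pdivrMr ?ltr0Sn //.
  by rewrite ler_pM2l ?divr_gt0 // ler_nat.
have lS : l \in fock_pred.
  apply/fock_predP; have [N NP] := ul 1 ltr01.
  exists (2 * sqn_of fock_dot (u N) + 2 * 1) => k.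
  have -> : l = fock_val (u N) + (- (fock_val (u N) - l)).
    by rewrite opprB addrCA subrr addr0.
  apply: le_trans (series_sqnD _ _ _) _; apply: lerD.
    by rewrite ler_wpM2l // series_sqn_le.
  rewrite ler_wpM2l // -scaleN1r series_sqnZ /=.
  rewrite sqrrN expr1n oppr0 expr0n /= addr0 mul1r.
  exact: NP.
exists (Fock lS) => e e0; have [N NP] := ul _ (divr_gt0 e0 (ltr0n _ 2)).
exists N => p pN; apply: le_lt_trans (_ : e / 2 < e); last by lra.
by apply: fock_sqn_le => k; apply: NP.
Qed.

HB.instance Definition _ := Lmodule_isHilbert.Build R fock
  fock_dot_linearl fock_dot_herm fock_dot_pos (hcomplete_sqrt fock_complete).

End Fock.

Reserved Notation "S \ob T" (at level 40, left associativity).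
Notation "S \ob T" := (bcomp S T) : ring_scope.

(* The Hilbert space adjoint: the unique S : K -> H with <T x, y> = <x, S y>;
   it exists by the Riesz representation theorem. *)
Definition adj (R : realType) (H K : hilbertType R) (T : bop H K) : bop K H :=
  xget 0 [set S : bop K H | forall x y, hdot (T x) y = hdot x (S y)].

(* In the order of R[i], 0 <= z means that z is real and nonnegative. *)
Definition opsd (R : realType) (H : hilbertType R) (T : bop H H) : Prop :=
  forall x, 0 <= hdot (T x) x.

Definition ople (R : realType) (H : hilbertType R) (S T : bop H H) : Prop :=
  opsd (T - S).

Definition reop (R : realType) (H : hilbertType R) (T : bop H H) : bop H H :=
  2^-1 *: (T + adj T).

(* The unique positive square root of P, which exists when P is positive. *)
Definition sqrtop (R : realType) (H : hilbertType R) (P : bop H H) : bop H H :=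
  xget 0 [set S : bop H H | opsd S /\ S \ob S = P].

Section Blocks.
Variables (R : realType) (H K : hilbertType R).

Lemma inr_op_subproof : bounded_linear (fun y : K => (0 : H, y)).
Proof.
split=> [a x y|]; first by congr pair; rewrite /= scaler0 addr0.
by exists 1 => y; rewrite mul1r /hnorm /sqn sqn_pair /= sqn0 add0r.
Qed.
Definition inr_op : bop K (H * K)%type := mkbop inr_op_subproof.

Lemma snd_op_subproof : bounded_linear (fun x : H * K => x.2).
Proof.
apply/bounded_linearP; split=> //; exists 1 => // x.
by rewrite mul1r [leRHS]sqn_pair lerDr sqn_ge0.
Qed.
Definition snd_op : bop (H * K)%type K := mkbop snd_op_subproof.

Lemma place_subproof (I : finType) (i : I) :
  bounded_linear (fun h : H => [ffun j => if j == i then h else 0]).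
Proof.
apply/bounded_linearP; split=> [a x y|].
  by apply/ffunP => j; rewrite !ffunE; case: eqP; rewrite // scaler0 addr0.
exists 1 => // h; rewrite mul1r [leLHS]sqn_ffun (bigD1 i) //= ffunE eqxx.
rewrite big1 ?addr0 // => j /negPf ji; rewrite ffunE ji; exact: sqn0.
Qed.
Definition place (I : finType) (i : I) : bop H {ffun I -> H} :=
  mkbop (place_subproof i).

Lemma component_subproof (I : finType) (i : I) :
  bounded_linear (fun f : {ffun I -> H} => f i).
Proof.
apply/bounded_linearP; split=> [a f g|]; first by rewrite !ffunE.
exists 1 => // f; rewrite mul1r [leRHS]sqn_ffun (bigD1 i) //= lerDl.
by apply: sumr_ge0 => j _; apply: sqn_ge0.
Qed.
Definition component (I : finType) (i : I) : bop {ffun I -> H} H :=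
  mkbop (component_subproof i).

End Blocks.

Section OperatorMatrix.
Variables (R : realType) (H K : hilbertType R) (p q : nat).
Variable M : 'M[bop H K]_(p, q).

Definition opmx_fun (f : {ffun 'I_q -> H}) : {ffun 'I_p -> K} :=
  [ffun i => \sum_j M i j (f j)].

Lemma bop_sumE (H' K' : hilbertType R) (J : Type) (r : seq J) (P : pred J)
    (F : J -> bop H' K') x :
  (\sum_(j <- r | P j) F j) x = \sum_(j <- r | P j) F j x.
Proof. by elim/big_rec2: _ => // j y S _ <-; rewrite bop_addE. Qed.

Lemma opmx_subproof : bounded_linear opmx_fun.
Proof.
have -> : opmx_fun =
    bop_val (\sum_(i < p) \sum_(j < q) (place K i \ob M i j \ob component H j)).
  apply: funext => f; apply/ffunP => i; rewrite ffunE bop_sumE sum_ffunE.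
  rewrite (bigD1 i) //= [X in _ + X]big1 ?addr0 => [|k ki].
    by rewrite bop_sumE sum_ffunE; apply: eq_bigr => j _; rewrite /= ffunE eqxx.
  rewrite bop_sumE sum_ffunE big1 // => j _.
  by rewrite /= ffunE eq_sym (negPf ki).
exact: bopP.
Qed.

Definition opmx : bop {ffun 'I_q -> H} {ffun 'I_p -> K} := mkbop opmx_subproof.

End OperatorMatrix.

Section Harnack.
Variables (R : realType) (n : nat).

Definition row_norm (H : hilbertType R) (X : 'I_n -> bop H H) : R :=
  Num.sqrt (opnorm (\sum_i X i \ob adj (X i))).

Definition row_contraction (H : hilbertType R) (X : 'I_n -> bop H H) : Prop :=
  row_norm X <= 1.

Definition strict_row_contraction (H : hilbertType R) (X : 'I_n -> bop H H) :
  Prop := row_norm X < 1.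

Definition monomial (H : hilbertType R) (X : 'I_n -> bop H H) (w : seq 'I_n) :
  bop H H := foldr (fun i S => X i \ob S) (bid H) w.

Definition ncpoly (m : nat) := {fsfun seq 'I_n -> 'M[R[i]]_m with 0}.

(* p(X) = \sum_w X_w (x) p_w, acting on H (x) C^m = H^(m). *)
Definition nceval (m : nat) (p : ncpoly m) (H : hilbertType R)
    (X : 'I_n -> bop H H) : bop {ffun 'I_m -> H} {ffun 'I_m -> H} :=
  opmx (\matrix_(i < m, j < m)
          \sum_(w <- finsupp p) (p w i j : R[i]) *: monomial X w).

Definition positive_real_part (K : hilbertType R) (m : nat) (p : ncpoly m) :
  Prop := forall X : 'I_n -> bop K K,
    strict_row_contraction X -> opsd (reop (nceval p X)).

Definition infinite_dimensional (K : hilbertType R) : Prop :=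
  forall (k : nat) (v : 'I_k -> K),
    exists x, forall c : 'I_k -> R[i], x <> \sum_i c i *: v i.

(* K is the infinite-dimensional space on which positivity is tested. *)
Definition harnack_dom (K H : hilbertType R) (A B : 'I_n -> bop H H) : Prop :=
  exists2 c : R, 0 < c & forall (m : nat) (p : ncpoly m),
    positive_real_part K p ->
    ople (reop (nceval p A)) ((c ^+ 2)%:C *: reop (nceval p B)).

Definition harnack_equiv (K H : hilbertType R) (A B : 'I_n -> bop H H) : Prop :=
  harnack_dom K A B /\ harnack_dom K B A.

End Harnack.

Section Creation.
Variables (R : realType) (n : nat) (D : hilbertType R).

Definition vacuum_fun (x : D) : seq 'I_n -> D := fun w => if nilp w then x else 0.

Lemma vacuum_series x k : series (degree_sqn (vacuum_fun x)) k <= sqn x.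
Proof.
rewrite /series /=; case: k => [|k]; first by rewrite big_geq // sqn_ge0.
rewrite big_nat_recl // big1_seq ?addr0 => [|j _].
  rewrite /degree_sqn (bigD1 [tuple]) //= big1 ?addr0 // => w.
  by rewrite tuple0 => /negP[]; apply/eqP.
by apply: big1 => w _; rewrite /vacuum_fun /nilp size_tuple sqn0.
Qed.

Lemma vacuum_fock x : vacuum_fun x \in @fock_pred R n D.
Proof. by apply/fock_predP; exists (sqn x); apply: vacuum_series. Qed.

Lemma vacuum_subproof : bounded_linear (fun x => Fock (vacuum_fock x)).
Proof.
apply/bounded_linearP; split=> [a x y|].
  apply: val_inj; apply: funext => w /=; rewrite /vacuum_fun !fctE.
  by case: nilp; rewrite // scaler0 addr0.
by exists 1 => // x; rewrite mul1r; apply: fock_sqn_le => k; apply: vacuum_series.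
Qed.
(* x |-> 1 (x) x, where 1 is the vacuum vector e_() of F^2(H_n). *)
Definition vacuum : bop D (fock n D) := mkbop vacuum_subproof.

(* S_i (x) I, where S_i e_w = e_i (x) e_w = e_(i w). *)
Definition creation_fun (i : 'I_n) (xi : seq 'I_n -> D) : seq 'I_n -> D :=
  fun w => if w is j :: w' then if j == i then xi w' else 0 else 0.

Lemma creation_series i xi k :
  series (degree_sqn (creation_fun i xi)) k <= series (degree_sqn xi) k.
Proof.
rewrite /series /=; case: k => [|k]; first by rewrite !big_geq.
rewrite big_nat_recl // [leRHS]big_nat_recr //= [leLHS]addrC; apply: lerD.
  apply: ler_sum => j _; rewrite {1}/degree_sqn.
  rewrite (bigID (fun w : j.+1.-tuple 'I_n => thead w == i)) /=.
  rewrite [X in _ + X]big1 => [|w]; last first.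
    by case/tupleP: w => a w; rewrite theadE /= => /negPf ->; rewrite sqn0.
  rewrite addr0 (reindex_onto (fun w : j.-tuple 'I_n => [tuple of i :: w])
    (fun w => [tuple of behead w])) /=; last first.
    by case/tupleP=> a w; rewrite theadE => /eqP ->; apply: val_inj.
  rewrite /degree_sqn le_eqVlt; apply/orP; left; apply/eqP.
  apply: eq_big => [w|w _]; last by rewrite eqxx.
  by rewrite theadE eqxx; apply/eqP/val_inj.
rewrite /degree_sqn big1 ?sumr_ge0 // => [w _|w _]; first exact: sqn_ge0.
by rewrite tuple0 sqn0.
Qed.

Lemma creation_fock i (x : fock n D) : creation_fun i x \in @fock_pred R n D.
Proof.
apply/fock_predP; have [M xM] := fock_bounded x.
by exists M => k; apply: le_trans (creation_series _ _ _) (xM k).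
Qed.

Lemma creation_subproof i : bounded_linear (fun x => Fock (creation_fock i x)).
Proof.
apply/bounded_linearP; split=> [a x y|].
  apply: val_inj; apply: funext => -[|j w] /=; rewrite ?fctE /=.
    by rewrite scaler0 addr0.
  by case: eqP => // _; rewrite scaler0 addr0.
exists 1 => // x; rewrite mul1r; apply: fock_sqn_le => k.
exact: le_trans (creation_series _ _ _) (series_sqn_le _ _).
Qed.
Definition creation (i : 'I_n) : bop (fock n D) (fock n D) :=
  mkbop (creation_subproof i).

End Creation.

Section Dilation.
Variables (R : realType) (n : nat) (H : hilbertType R).
Variable T : 'I_n -> bop H H.

(* The operator Delta_(T^* ); it acts on H^(n). *)
Definition defect_op : bop {ffun 'I_n -> H} {ffun 'I_n -> H} :=
  sqrtop (opmx (\matrix_(i < n, j < n)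
    (((i == j)%:R : R[i]) *: bid H - adj (T i) \ob T j))).

Definition defect_space : hilbertType R := clran defect_op.

Lemma to_defect_subproof : bounded_linear (to_clran defect_op).
Proof.
apply/bounded_linearP; split=> [a x y|].
  by apply: val_inj; rewrite /= linearP.
have [M M0 DM] := bop_sqnP defect_op; exists M => // x; exact: DM.
Qed.
Definition to_defect : bop {ffun 'I_n -> H} defect_space := mkbop to_defect_subproof.

Definition defect_col (i : 'I_n) : bop H (fock n defect_space) :=
  vacuum n defect_space \ob to_defect \ob place H i.

Definition dilation_space : hilbertType R := (H * fock n defect_space)%type.

Lemma dilation_subproof (i : 'I_n) : bounded_linear (fun x : dilation_space =>
  (T i x.1, defect_col i x.1 + creation defect_space i x.2) : dilation_space).
Proof.
apply/bounded_linearP; split=> [a x y|].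
  congr pair; first by rewrite linearP.
  rewrite !linearP /=.
  set u := defect_col i x.1; set v := creation _ i x.2.
  by rewrite addrACA -scalerDr.
have [M M0 TM] := bop_sqnP (T i).
have [N N0 DN] := bop_sqnP (defect_col i).
have [P P0 SP] := bop_sqnP (creation defect_space i).
exists (M + 2 * N + 2 * P) => [|x]; first by rewrite !addr_ge0 ?mulr_ge0.
rewrite [leLHS]sqn_pair [sqn x]sqn_pair /=.
have := sqnD_le (defect_col i x.1) (creation defect_space i x.2).
have := TM x.1; have := DN x.1; have := SP x.2.
have := sqn_ge0 x.1; have := sqn_ge0 x.2.
nra.
Qed.
Definition dilation (i : 'I_n) : bop dilation_space dilation_space :=
  mkbop (dilation_subproof i).

End Dilation.

Section Intertwiners.
Variables (R : realType) (n : nat) (H : hilbertType R).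
Implicit Types A B : 'I_n -> bop H H.

(* L_(B, A), the unique operator K_B -> K_A which is the identity on H and
   intertwines the dilations; it exists as soon as B Harnack dominates A. *)
Definition Lop B A : bop (dilation_space B) (dilation_space A) :=
  xget 0 [set L : bop (dilation_space B) (dilation_space A) |
    (forall h : H, L (h, 0) = (h, 0)) /\
    (forall i, L \ob dilation B i = dilation A i \ob L)].

(* Theta_(B, A), the lower right entry of L_(B, A)^*. *)
Definition Theta B A : bop (fock n (defect_space A)) (fock n (defect_space B)) :=
  snd_op H (fock n (defect_space B)) \ob adj (Lop B A)
    \ob inr_op H (fock n (defect_space A)).

Definition multi_analytic (D E : hilbertType R) (M : bop (fock n D) (fock n E)) :
  Prop := forall i, M \ob creation D i = creation E i \ob M.

End Intertwiners.

Definition inverse_ops (R : realType) (H K : hilbertType R)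
    (S : bop H K) (T : bop K H) : Prop := T \ob S = bid H /\ S \ob T = bid K.

Definition invertible (R : realType) (H K : hilbertType R) (S : bop H K) : Prop :=
  exists T : bop K H, inverse_ops S T.

(* Main.v *)
From Pilot Require Import Defs.
From mathcomp Require Import all_boot all_order all_algebra.
From mathcomp Require Import sesquilinear complex finmap.
From mathcomp Require Import boolp classical_sets reals.
From mathcomp Require Import topology normedtype sequences ring lra.

(* Idea.  Since the isometries V_i of the minimal dilation of T have orthogonal
   ranges, the Gram matrix of the vectors V_w h, for finitely many words w and
   h in H, only involves T; it is the real part of a polynomial in T which is
   positive on every row contraction.  Testing A < B on these polynomials bounds
   |sum V_w^A h_w| by c |sum V_w^B h_w|, and minimality yields L_(B, A).
   Conversely, let L be an intertwiner with |L| <= c and D^2 = 1 - (L/c)^* (L/c).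
   Then D V_i^B = W_i D for a row isometry W on the closed range of D, and a
   polynomial p with positive real part has Re p(W) >= 0, that is,
   c^2 Re p(B) - Re p(A) >= 0.  Here positivity on K passes to any row
   contraction, because p(X) f only involves the finite-dimensional span of the
   X_w f_j, which embeds in K.
   So domination means existence of an intertwiner; intertwiners are unique, hence
   compose, and L^* is triangular with corners I and Theta, so that L is
   invertible exactly when Theta is. *)

Set Implicit Arguments.
Unset Strict Implicit.
Unset Printing Implicit Defensive.

Import Order.TTheory GRing.Theory Num.Theory.
Import numFieldNormedType.Exports.
(* Again, after Num.Theory: both export ReM and ImM. *)
Import Pilot.Defs.

Local Open Scope ring_scope.
Local Open Scope complex_scope.
Local Open Scope classical_set_scope.

(** * Hilbert spaces *)

Section RealLimits.
Variable R : realType.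

Lemma cvg0Mr (c : R) (v : nat -> R) :
  v @ \oo --> (0 : R) -> c * v p @[p --> \oo] --> (0 : R).
Proof. by move=> v0; rewrite -(mulr0 c); apply: cvgMl_tmp. Qed.

Lemma cvg_bigsum (I : Type) (s : seq I) (F : I -> nat -> R) (l : I -> R) :
  (forall i, F i @ \oo --> l i) ->
  \sum_(i <- s) F i k @[k --> \oo] --> \sum_(i <- s) l i.
Proof.
move=> Fl; elim: s => [|i s IH].
  by under eq_fun do rewrite big_nil; rewrite big_nil; apply: cvg_cst.
by under eq_fun do rewrite big_cons; rewrite big_cons; apply: cvgD.
Qed.

End RealLimits.

Section InnerProduct.
Variables (R : realType) (H : hilbertType R).
Implicit Types x y z : H.

Lemma hdot0r x : hdot x 0 = 0.
Proof. exact: linear0r. Qed.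

Lemma hdotNl x y : hdot (- x) y = - hdot x y.
Proof. exact: linearNl. Qed.

Lemma hdotNr x y : hdot x (- y) = - hdot x y.
Proof. exact: linearNr. Qed.

Lemma hdotBl x y z : hdot (x - y) z = hdot x z - hdot y z.
Proof. exact: linearBl. Qed.

Lemma hdotBr x y z : hdot x (y - z) = hdot x y - hdot x z.
Proof. exact: linearBr. Qed.

Lemma hdot_suml (I : Type) (r : seq I) (P : pred I) (F : I -> H) y :
  hdot (\sum_(i <- r | P i) F i) y = \sum_(i <- r | P i) hdot (F i) y.
Proof.
by apply: (big_morph (fun x => hdot x y)) => [u v|]; rewrite ?hdotDl ?hdot0l.
Qed.

Lemma hdot_sumr (I : Type) (r : seq I) (P : pred I) (F : I -> H) x :
  hdot x (\sum_(i <- r | P i) F i) = \sum_(i <- r | P i) hdot x (F i).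
Proof. by apply: (big_morph (hdot x)) => [u v|]; rewrite ?hdotDr ?hdot0r. Qed.

Lemma ReN (a : R[i]) : complex.Re (- a) = - complex.Re a.
Proof. by case: a. Qed.

Lemma ImN (a : R[i]) : complex.Im (- a) = - complex.Im a.
Proof. by case: a. Qed.

Lemma sqnB x y : sqn (x - y) = sqn x + sqn y - 2 * complex.Re (hdot x y).
Proof. by rewrite sqnD sqnN hdotNr ReN mulrN. Qed.

Lemma sqn_eq0 x : sqn x = 0 -> x = 0.
Proof.
by move=> x0; apply/eqP/negPn/negP => /sqn_gt0; rewrite x0 ltxx.
Qed.

(** Since [Re (f (i x)) = - Im (f x)], a complex homogeneous functional is determined by its real
    part; identities of inner products may thus be checked on real parts. *)
Lemma hdot_real_eq (f g : H -> R[i]) :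
  (forall a x, f (a *: x) = a * f x) -> (forall a x, g (a *: x) = a * g x) ->
  (forall x, complex.Re (f x) = complex.Re (g x)) -> f =1 g.
Proof.
move=> fZ gZ fg x; apply: complex_eq => //.
by have := fg ((0 +i* 1) *: x); rewrite fZ gZ !ReM /=; lra.
Qed.

Lemma hdot_eq0 x : (forall y, hdot x y = 0) -> x = 0.
Proof. by move=> x0; apply: sqn_eq0; rewrite /sqn /sqn_of x0. Qed.

(** Cauchy-Schwarz for the real inner product [Re <x, y>]: subtract from [x] its real projection
    [t y] and use that the remainder has nonnegative square norm. *)
Lemma Re_hdot_sqr x y : complex.Re (hdot x y) ^+ 2 <= sqn x * sqn y.
Proof.
have [->|y0] := eqVneq y 0; first by rewrite hdot0r sqn0 /= mulr0 expr0n.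
have yp := sqn_gt0 y0.
pose t := complex.Re (hdot x y) / sqn y.
have := sqn_ge0 (x - t%:C *: y).
rewrite sqnB sqnZ hdotZr ReM Re_conj Im_conj /= => h.
have e : t * sqn y = complex.Re (hdot x y) by rewrite divfK // gt_eqF.
have : 0 <= (sqn x + (t ^+ 2 + 0 ^+ 2) * sqn y -
  2 * (t * complex.Re (hdot x y) - - 0 * complex.Im (hdot x y))) * sqn y.
  by rewrite mulr_ge0 // ltW.
rewrite -e; nra.
Qed.

Lemma Re_hdot_hnorm x y : `|complex.Re (hdot x y)| <= hnorm x * hnorm y.
Proof.
rewrite -(@ler_pXn2r _ 2) ?nnegrE ?mulr_ge0 ?hnorm_ge0 // real_normK ?num_real //.
by rewrite exprMn !sqr_hnorm; exact: Re_hdot_sqr.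
Qed.

Lemma hnorm0 : hnorm (0 : H) = 0.
Proof. by rewrite /hnorm sqn0 sqrtr0. Qed.

Lemma hnorm_opp x : hnorm (- x) = hnorm x.
Proof. by rewrite /hnorm sqnN. Qed.

Lemma hnormBC x y : hnorm (x - y) = hnorm (y - x).
Proof. by rewrite -hnorm_opp opprB. Qed.

Lemma hnorm_triangle x y : hnorm (x + y) <= hnorm x + hnorm y.
Proof.
rewrite -(@ler_pXn2r _ 2) ?nnegrE ?addr_ge0 ?hnorm_ge0 //.
rewrite sqrrD !sqr_hnorm sqnD; have := Re_hdot_hnorm x y.
by rewrite ler_norml => /andP[_]; lra.
Qed.

Lemma hnormB3 x y z : hnorm (x - z) <= hnorm (x - y) + hnorm (y - z).
Proof.
have -> : x - z = (x - y) + (y - z) by rewrite addrA subrK.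
exact: hnorm_triangle.
Qed.

Lemma hnormZ (a : R[i]) x :
  hnorm (a *: x) = Num.sqrt (complex.Re a ^+ 2 + complex.Im a ^+ 2) * hnorm x.
Proof. by rewrite /hnorm sqnZ sqrtrM // addr_ge0 // sqr_ge0. Qed.

Lemma hnormZr (a : R) x : 0 <= a -> hnorm (a%:C *: x) = a * hnorm x.
Proof. by move=> a0; rewrite hnormZ /= expr0n addr0 sqrtr_sqr ger0_norm. Qed.

Lemma hnorm_eq0 x : hnorm x = 0 -> x = 0.
Proof. by move=> x0; apply: sqn_eq0; rewrite -sqr_hnorm x0 expr0n. Qed.

(** Norm convergence is phrased as a limit of real numbers, so that real limit theorems apply
    without a topology on [H]. *)
Definition hlim (u : nat -> H) (l : H) : Prop :=
  hnorm (u p - l) @[p --> \oo] --> (0 : R).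

Lemma hlimP u l : hlim u l <->
  forall e : R, 0 < e -> exists N, forall p, (N <= p)%N -> hnorm (u p - l) < e.
Proof.
split=> [ul e e0|ul].
  move/cvgr0Pnorm_lt: ul => /(_ e e0)[N _ NP]; exists N => p /NP /=.
  by rewrite ger0_norm // hnorm_ge0.
apply/cvgr0Pnorm_lt => e /ul[N NP]; exists N => // p /NP /=.
by rewrite ger0_norm // hnorm_ge0.
Qed.

Lemma hlim_le u l (v : nat -> R) :
  (forall p, hnorm (u p - l) <= v p) -> v @ \oo --> (0 : R) -> hlim u l.
Proof.
move=> uv v0; apply: (@squeeze_cvgr _ _ _ _ (fun=> 0) v); first last.
- exact: v0.
- exact: cvg_cst.
by apply: nearW => p; rewrite hnorm_ge0 uv.
Qed.

Lemma hlim_cst l : hlim (fun=> l) l.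
Proof. by rewrite /hlim subrr hnorm0; apply: cvg_cst. Qed.

Lemma hlimD u v k l : hlim u k -> hlim v l -> hlim (u \+ v) (k + l).
Proof.
move=> uk vl; apply: (@hlim_le _ _ (fun p => hnorm (u p - k) + hnorm (v p - l))).
  by move=> p /=; rewrite opprD addrACA hnorm_triangle.
by rewrite -[X in _ --> X](addr0 0); apply: cvgD.
Qed.

Lemma hlimZ (a : R[i]) u l : hlim u l -> hlim (fun p => a *: u p) (a *: l).
Proof.
move=> ul; apply: hlim_le (cvg0Mr _ ul) => p.
by rewrite -scalerBr hnormZ.
Qed.

Lemma hlim_uniq u k l : hlim u k -> hlim u l -> k = l.
Proof.
move=> uk ul; apply/eqP; rewrite -subr_eq0; apply/eqP/hnorm_eq0.
apply/eqP; rewrite eq_le hnorm_ge0 andbT.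
have : hnorm (u p - k) + hnorm (u p - l) @[p --> \oo] --> (0 + 0 : R) by apply: cvgD.
rewrite addr0 => c; apply: (ler_cvg_to (@cvg_cst _ _ _ _ _) c); apply: nearW => p.
by rewrite (hnormBC (u p)) hnormB3.
Qed.

Lemma hlim_sum (I : Type) (s : seq I) (F : I -> nat -> H)
    (l : I -> H) : (forall i, hlim (F i) (l i)) ->
  hlim (fun k => \sum_(i <- s) F i k) (\sum_(i <- s) l i).
Proof.
move=> Fl; elim: s => [|i s IH].
  by under eq_fun do rewrite big_nil; rewrite big_nil; apply: hlim_cst.
under eq_fun do rewrite big_cons; rewrite big_cons.
exact: (hlimD (Fl i) IH).
Qed.

Lemma hlim_shift u l : hlim u l -> hlim (fun p => u p.+1) l.
Proof.
move=> /hlimP ul; apply/hlimP => e /ul[N NP]; exists N => p pN.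
exact/NP/leqW.
Qed.

Lemma hlim_Re_dot u l y : hlim u l ->
  complex.Re (hdot (u p) y) @[p --> \oo] --> complex.Re (hdot l y).
Proof.
move=> ul; apply/subr_cvg0.
have c : hnorm (u p - l) * hnorm y @[p --> \oo] --> (0 : R).
  by under eq_fun do rewrite mulrC; apply: cvg0Mr.
apply: (@squeeze_cvgr _ _ _ _ (fun p => - (hnorm (u p - l) * hnorm y)) _ _ _ _ _ c).
  apply: nearW => p; rewrite -ler_norml -ReN -ReD -hdotNl -hdotDl.
  exact: Re_hdot_hnorm.
by rewrite -[X in _ --> X]oppr0; apply: cvgN.
Qed.

Lemma hlim_hnorm u l : hlim u l -> hnorm (u p) @[p --> \oo] --> hnorm l.
Proof.
move=> ul; apply/subr_cvg0.
apply: (@squeeze_cvgr _ _ _ _ (fun p => - hnorm (u p - l)) _ _ _ _ _ ul).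
  apply: nearW => p.
  have := hnormB3 (u p) l 0; have := hnormB3 l (u p) 0.
  by rewrite !subr0 (hnormBC l); lra.
by rewrite -[X in _ --> X]oppr0; apply: cvgN.
Qed.

Lemma hlim_sqn (u : nat -> H) l :
  hlim u l -> sqn (u k) @[k --> \oo] --> sqn l.
Proof.
move=> ul; under eq_fun do rewrite -sqr_hnorm; rewrite -sqr_hnorm.
by apply: cvgM; apply: hlim_hnorm.
Qed.

Lemma hcauchy_lim (u : nat -> H) :
  (forall e : R, 0 < e -> exists N, forall p q, (N <= p)%N -> (N <= q)%N ->
     hnorm (u p - u q) < e) -> exists l, hlim u l.
Proof. by move=> /(@hilbert_complete R H)[l lP]; exists l; apply/hlimP. Qed.

End InnerProduct.

Section Operators.
Variables (R : realType) (H K : hilbertType R).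

Lemma hnorm_le_sqn (x : H) (y : K) (c : R) : 0 <= c ->
  (hnorm x <= c * hnorm y) = (sqn x <= c ^+ 2 * sqn y).
Proof.
move=> c0; rewrite -!sqr_hnorm -exprMn ler_pXn2r ?nnegrE ?hnorm_ge0 //.
by rewrite mulr_ge0 // hnorm_ge0.
Qed.

Lemma bop_bound (T : bop H K) :
  exists2 M : R, 0 < M & forall x, hnorm (T x) <= M * hnorm x.
Proof.
have [_ [M MP]] := bopP T; exists (`|M| + 1); first by rewrite ltr_wpDl.
move=> x; apply: le_trans (MP x) _; rewrite ler_wpM2r ?hnorm_ge0 //.
by apply: le_trans (ler_norm _) _; rewrite lerDl.
Qed.

Lemma hlim_bop (T : bop H K) u l : hlim u l -> hlim (fun p => T (u p)) (T l).
Proof.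
have [M M0 TM] := bop_bound T => ul.
apply: hlim_le (cvg0Mr M ul) => p.
by rewrite -linearB TM.
Qed.

End Operators.

(** * Adjoints *)

Section Riesz.
Variables (R : realType) (H : hilbertType R).
Implicit Types x y z : H.

(** At [t = - b / (a + 1)] the form equals [- t ^+ 2], which forces [t = 0]; the divisor [a + 1] is
    positive even when [a = 0]. *)
Lemma quadratic_ge0_linear0 (a b : R) :
  (forall t, 0 <= a * t ^+ 2 + b * t) -> b = 0.
Proof.
move=> ab; have a0 : 0 <= a by have := ab 1; have := ab (-1); lra.
have a1 : 0 < a + 1 by rewrite ltr_wpDl.
have h := ab (- b / (a + 1)); set t := - b / (a + 1) in h.
have e : b = - t * (a + 1) by rewrite /t mulNr divfK ?opprK // gt_eqF.
suff t0 : t = 0 by rewrite e t0 oppr0 mul0r.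
apply/eqP; rewrite -sqrf_eq0 eq_le sqr_ge0 andbT.
by rewrite e in h; nra.
Qed.

(* The minimiser of sqn x - 2 Re (f x) represents f. *)
Lemma riesz (f : H -> R[i]) (M : R) :
  (forall (a : R[i]) x y, f (a *: x + y) = a * f x + f y) ->
  (forall x, `|complex.Re (f x)| <= M * hnorm x) ->
  exists z, forall x, f x = hdot x z.
Proof.
move=> fl fM.
have f0 : f 0 = 0 by have := fl 1 0 0; rewrite scaler0 mul1r addr0 => /esym/eqP;
  rewrite addrC -subr_eq0 addrK => /eqP.
have fZ a x : f (a *: x) = a * f x by rewrite -[a *: x]addr0 fl f0 addr0.
have fD x y : f (x + y) = f x + f y by rewrite -{1}[x]scale1r fl mul1r.
pose J x := sqn x - 2 * complex.Re (f x).
have J_lb x : - M ^+ 2 <= J x.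
  have := fM x; rewrite ler_norml => /andP[_ h].
  have := sqr_ge0 (hnorm x - M); rewrite /J -sqr_hnorm; nra.
pose d := inf [set J x | x in [set: H]].
have Jinf : has_inf [set J x | x in [set: H]].
  split; first by exists (J 0), 0.
  by exists (- M ^+ 2) => _ [x _ <-].
have dJ x : d <= J x by apply: ge_inf; [exact: Jinf.2|exists x].
have /boolp.choice[u uP] : forall k : nat, exists x, J x < d + k.+1%:R^-1.
  move=> k; have /(inf_adherent)/(_ Jinf)[_ [x _ <-] xd] : (0 : R) < k.+1%:R^-1.
    by rewrite invr_gt0.
  by exists x.
(* Parallelogram law: [sqn (x - y) = 2 J x + 2 J y - 4 J ((x + y) / 2)], and the midpoint value is
   at least [d]. Hence minimising sequences are Cauchy. *)
have par x y : sqn (x - y) <= 2 * J x + 2 * J y - 4 * d.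
  have := dJ (2^-1%:C *: (x + y)); rewrite /J sqnZ fZ fD sqnD sqnB ReM ReD /=.
  by lra.
have [|z uz] := @hcauchy_lim _ _ u.
  move=> e e0.
  have [N _ NP] : \forall k \near \oo, (4 * k.+1%:R^-1 : R) < e ^+ 2.
    apply: (cvgr_lt (0 : R)); last exact: exprn_gt0.
    by apply: cvg0Mr; apply: cvg_harmonic.
  exists N => p q pN qN; rewrite /hnorm sqrt_lt //.
  apply: le_lt_trans (par _ _) _.
  have := uP p; have := uP q; have := NP p pN; have := NP q qN.
  by move: (p.+1%:R^-1 : R) (q.+1%:R^-1 : R) => a b; lra.
have zd : J z <= d.
  have c1 : J (u k) @[k --> \oo] --> J z.
    apply: cvgB; first exact: hlim_sqn.
    apply: cvgMl_tmp; apply/subr_cvg0.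
    have c : M * hnorm (u p - z) @[p --> \oo] --> (0 : R) by apply: cvg0Mr.
    apply: (@squeeze_cvgr _ _ _ _ (fun p => - (M * hnorm (u p - z))) _ _ _ _ _ c).
      apply: nearW => p; rewrite -ler_norml.
      have -> : complex.Re (f (u p)) - complex.Re (f z) = complex.Re (f (u p - z)).
        by rewrite fD -(scaleN1r z) fZ mulN1r ReD ReN.
      exact: fM.
    by rewrite -[X in _ --> X]oppr0; apply: cvgN.
  have c2 : d + k.+1%:R^-1 @[k --> \oo] --> (d + 0 : R).
    by apply: cvgD; [exact: cvg_cst|exact: cvg_harmonic].
  rewrite -[d]addr0; apply: (ler_cvg_to c1 c2); apply: nearW => p.
  exact/ltW/uP.
exists z; apply: hdot_real_eq => [//|a x|x]; first by rewrite hdotZl.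
apply/eqP; rewrite eq_sym -subr_eq0; apply/eqP.
suff : 2 * (complex.Re (hdot x z) - complex.Re (f x)) = 0.
  by move/eqP; rewrite mulf_eq0 pnatr_eq0 => /eqP.
(* First variation at the minimiser: [J (z + t x) - J z] is this quadratic polynomial in [t]. *)
apply: (@quadratic_ge0_linear0 (sqn x)) => t.
have := le_trans zd (dJ (z + t%:C *: x)).
rewrite /J fD fZ sqnD sqnZ hdotZr ReD !ReM Re_conj Im_conj (hdot_herm x z) Re_conj /=.
by lra.
Qed.

End Riesz.

Section Adjoint.
Variables (R : realType).
Implicit Types (H K L : hilbertType R).

Lemma adjoint_exists H K (T : bop H K) :
  exists S : bop K H, forall x y, hdot (T x) y = hdot x (S y).
Proof.
have [M M0 TM] := bop_bound T.
have /boolp.choice[S SP] : forall y, exists z, forall x, hdot (T x) y = hdot x z.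
  move=> y; apply: (@riesz _ _ _ (M * hnorm y)) => [a x x'|x].
    by rewrite linearP hdotDl hdotZl.
  apply: le_trans (Re_hdot_hnorm _ _) _.
  by rewrite mulrAC ler_wpM2r ?hnorm_ge0.
have Sl : linear S.
  move=> a x y; apply/eqP; rewrite -subr_eq0; apply/eqP/hdot_eq0 => z.
  rewrite hdot_herm hdotBr hdotDr hdotZr -!SP hdotDr hdotZr.
  by rewrite subrr rmorph0.
have Sb : bounded_linear S.
  split=> //; exists M => y; have [->|Sy0] := eqVneq (hnorm (S y)) 0.
    by rewrite mulr_ge0 ?hnorm_ge0 // ltW.
  (* Divide [|S y|^2 = <T (S y), y> <= M |S y| |y|] by [|S y|]. *)
  have Sp : 0 < hnorm (S y) by rewrite lt_neqAle eq_sym Sy0 hnorm_ge0.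
  rewrite -(ler_pM2l Sp) -expr2 sqr_hnorm /sqn /sqn_of -SP.
  apply: le_trans (ler_norm _) _; apply: le_trans (Re_hdot_hnorm _ _) _.
  by rewrite mulrA (mulrC _ M) ler_wpM2r ?hnorm_ge0.
by exists (mkbop Sb).
Qed.

Lemma adjP H K (T : bop H K) x y : hdot (T x) y = hdot x (adj T y).
Proof. exact: (xgetPex 0 (adjoint_exists T)). Qed.

Lemma adjPr H K (T : bop H K) x y : hdot x (T y) = hdot (adj T x) y.
Proof. by rewrite hdot_herm adjP -hdot_herm. Qed.

Lemma adj_uniq H K (T : bop H K) (S : bop K H) :
  (forall x y, hdot (T x) y = hdot x (S y)) -> adj T = S.
Proof.
move=> TS; apply: bop_ext => y; apply/eqP; rewrite -subr_eq0; apply/eqP/hdot_eq0 => x.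
by rewrite hdot_herm hdotBr -adjP TS subrr rmorph0.
Qed.

Lemma adjK H K (T : bop H K) : adj (adj T) = T.
Proof. by apply: adj_uniq => x y; rewrite adjPr. Qed.

Lemma adj_comp H K L (S : bop K L) (T : bop H K) : adj (S \ob T) = adj T \ob adj S.
Proof. by apply: adj_uniq => x y /=; rewrite !adjP. Qed.

Lemma adjD H K (S T : bop H K) : adj (S + T) = adj S + adj T.
Proof. by apply: adj_uniq => x y; rewrite !bop_addE hdotDl hdotDr !adjP. Qed.

Lemma adj_id H : adj (bid H) = bid H.
Proof. exact: adj_uniq. Qed.

Lemma adj_bound H K (T : bop H K) (c : R) y : 0 <= c ->
  (forall x, hnorm (T x) <= c * hnorm x) -> hnorm (adj T y) <= c * hnorm y.
Proof.
move=> c0 Tc; have e : sqn (adj T y) = complex.Re (hdot (T (adj T y)) y).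
  by rewrite adjP.
have [->|Ty0] := eqVneq (hnorm (adj T y)) 0; first by rewrite mulr_ge0 ?hnorm_ge0.
have Tp : 0 < hnorm (adj T y) by rewrite lt_neqAle eq_sym Ty0 hnorm_ge0.
rewrite -(ler_pM2l Tp) -expr2 sqr_hnorm e; apply: le_trans (ler_norm _) _.
apply: le_trans (Re_hdot_hnorm _ _) _; rewrite mulrA ler_wpM2r ?hnorm_ge0 //.
by rewrite mulrC.
Qed.

(** The form of [reop T] is real, so the operator inequalities in Harnack domination become
    inequalities between real numbers [Re <T x, x>]. *)
Lemma hdot_reop H (T : bop H H) x :
  hdot (reop T x) x = (complex.Re (hdot (T x) x))%:C.
Proof.
rewrite /reop bop_scaleE bop_addE hdotZl hdotDl -adjPr (hdot_herm x).
have n2 : (2 : R[i]) != 0 by rewrite pnatr_eq0.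
apply: (mulfI n2); rewrite mulVKf // mulr_natl mulr2n.
by case: hdot => a b; apply: complex_eq => //=; lra.
Qed.

Lemma opsd_reopE H (T : bop H H) :
  opsd (reop T) <-> forall x, 0 <= complex.Re (hdot (T x) x).
Proof. by split=> T0 x; have := T0 x; rewrite hdot_reop lecE /= ?eqxx. Qed.

Lemma ople_reopE H (S T : bop H H) (c : R) :
  ople (reop S) (c%:C *: reop T) <->
  forall x, complex.Re (hdot (S x) x) <= c * complex.Re (hdot (T x) x).
Proof.
have E x : hdot ((c%:C *: reop T - reop S) x) x =
    (c * complex.Re (hdot (T x) x) - complex.Re (hdot (S x) x))%:C.
  rewrite (_ : (c%:C *: reop T - reop S) x =
    c%:C *: reop T x - reop S x) // hdotBl hdotZl !hdot_reop.
  by apply: complex_eq; rewrite ?ReD ?ImD ?ReM ?ImM /=; ring.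
by split=> ST x; have := ST x; rewrite E lecE /= eqxx subr_ge0.
Qed.

End Adjoint.

(** * Row contractions and square roots *)

Section RowNorm.
Variables (R : realType) (n : nat).

Lemma opnorm_ge (H K : hilbertType R) (T : bop H K) x :
  hnorm (T x) <= opnorm T * hnorm x.
Proof.
have [x0|x0] := eqVneq (hnorm x) 0.
  by rewrite (hnorm_eq0 x0) linear0 !hnorm0 mulr0.
have xp : 0 < hnorm x by rewrite lt_neqAle eq_sym x0 hnorm_ge0.
have ip : 0 <= (hnorm x)^-1 by rewrite invr_ge0 ltW.
rewrite -ler_pdivrMr // mulrC -hnormZr // -linearZ.
apply: ub_le_sup; last by exists ((hnorm x)^-1%:C *: x) => //=; rewrite hnormZr // mulVf.
have [M M0 TM] := bop_bound T; exists M => _ [y /= y1 <-].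
by apply: le_trans (TM _) _; rewrite ler_piMr // ltW.
Qed.

Lemma opnorm_le (H K : hilbertType R) (T : bop H K) (r : R) : 0 <= r ->
  (forall x, hnorm (T x) <= r * hnorm x) -> opnorm T <= r.
Proof.
move=> r0 Tr; apply: ge_sup; first by exists (hnorm (T 0)), 0; rewrite //= hnorm0.
by move=> _ [y /= y1 <-]; apply: le_trans (Tr _) _; rewrite ler_piMr.
Qed.

(** The row operator [(X_1, ..., X_n)] from [H^(n)] to [H] has squared norm at most [r]; this form
    avoids adjoints. *)
Definition row_le (H : hilbertType R) (X : 'I_n -> bop H H) (r : R) : Prop :=
  forall u : 'I_n -> H, sqn (\sum_i X i (u i)) <= r * \sum_i sqn (u i).

Lemma row_adj_dot (H : hilbertType R) (X : 'I_n -> bop H H) y :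
  \sum_i sqn (adj (X i) y) =
  complex.Re (hdot ((\sum_i X i \ob adj (X i)) y) y).
Proof.
rewrite bop_sumE hdot_suml Re_sum; apply: eq_bigr => i _ /=.
by rewrite adjP.
Qed.

(** A row and its adjoint column have the same norm. With [y = X u] and [|X^* y| <= |y|], expanding
    [0 <= |u - X^* y|^2] gives [|y|^2 <= |u|^2]. *)
Lemma row_contraction_le (H : hilbertType R) (X : 'I_n -> bop H H) :
  row_contraction X -> row_le X 1.
Proof.
rewrite /row_contraction /row_norm -{1}sqrtr1 ler_sqrt ?ltr01 // => X1 u.
set y := \sum_i X i (u i); rewrite mul1r.
have ydot : sqn y = \sum_i complex.Re (hdot (u i) (adj (X i) y)).
  rewrite {1}/sqn /sqn_of {1}/y hdot_suml Re_sum; apply: eq_bigr => i _.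
  by rewrite adjP.
have yle : \sum_i sqn (adj (X i) y) <= sqn y.
  rewrite row_adj_dot; apply: le_trans (ler_norm _) _.
  apply: le_trans (Re_hdot_hnorm _ _) _; rewrite -sqr_hnorm expr2.
  apply: ler_wpM2r; first exact: hnorm_ge0.
  by apply: le_trans (opnorm_ge _ _) _; rewrite ler_piMl ?hnorm_ge0.
have : 0 <= \sum_i sqn (u i - adj (X i) y) by apply: sumr_ge0 => i _; apply: sqn_ge0.
under eq_bigr do rewrite sqnB.
by rewrite !big_split /= sumrN -mulr_sumr -ydot; lra.
Qed.

(** For [Z = X X^*], the chain [|Z y|^2 <= r |X^* y|^2 = r Re <Z y, y> <= r |Z y| |y|] bounds the
    norm of [Z] by [r]. *)
Lemma row_le_strict (H : hilbertType R) (X : 'I_n -> bop H H) (r : R) :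
  0 <= r < 1 -> row_le X r -> strict_row_contraction X.
Proof.
move=> /andP[r0 r1] Xr; rewrite /strict_row_contraction /row_norm -sqrtr1.
rewrite ltr_sqrt ?ltr01 //; apply: le_lt_trans r1; apply: opnorm_le => // y.
set Z := \sum_i _; have := Xr (fun i => adj (X i) y).
have -> : \sum_i X i (adj (X i) y) = Z y by rewrite bop_sumE.
rewrite row_adj_dot -/Z -sqr_hnorm => h.
have [->|Zy0] := eqVneq (hnorm (Z y)) 0; first by rewrite mulr_ge0 ?hnorm_ge0.
have Zp : 0 < hnorm (Z y) by rewrite lt_neqAle eq_sym Zy0 hnorm_ge0.
rewrite -(ler_pM2l Zp) -expr2; apply: le_trans h _.
rewrite mulrCA ler_wpM2l //; apply: le_trans (ler_norm _) _.
exact: Re_hdot_hnorm.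
Qed.

End RowNorm.

Section SquareRoot.
Variables (R : realType) (H : hilbertType R).

(** The sesquilinear form [B] vanishes on the diagonal because [<S x, x>] is real. Polarisation
    makes it antisymmetric, and replacing [x] by [i x] makes it symmetric, so it is zero. *)
Lemma opsd_selfadj (S : bop H H) : opsd S -> forall x y, hdot (S x) y = hdot x (S y).
Proof.
move=> S0; pose B x y := hdot (S x) y - hdot x (S y).
have Bxx x : B x x = 0.
  rewrite /B (hdot_herm x); have := S0 x; rewrite lecE => /andP[/eqP].
  by case: hdot => a b /= -> _; apply: complex_eq => /=; lra.
have BD x y : B x y + B y x = 0.
  have := Bxx (x + y); have := Bxx x; have := Bxx y.
  rewrite /B !linearD /= !hdotDl !hdotDr => hy hx hxy.
  have -> : hdot (S x) y - hdot x (S y) + (hdot (S y) x - hdot y (S x)) =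
    (hdot (S x) x + hdot (S x) y + (hdot (S y) x + hdot (S y) y) -
     (hdot x (S x) + hdot x (S y) + (hdot y (S x) + hdot y (S y)))) -
    (hdot (S x) x - hdot x (S x)) - (hdot (S y) y - hdot y (S y)) by ring.
  by rewrite hx hy hxy !subr0.
move=> x y; have h1 := BD x y; have h2 := BD ('i *: x) y.
have {}h2 : 'i * (B x y - B y x) = 0.
  rewrite -h2 /B !linearZ /= !hdotZl !hdotZr conjCi; ring.
have {}h2 : B x y = B y x.
  by apply/eqP; rewrite -subr_eq0; move/eqP: h2; rewrite mulf_eq0 (negPf (neq0Ci _)).
have : 2 * B x y = 0 by rewrite -h1 -h2; ring.
by move/eqP; rewrite mulf_eq0 pnatr_eq0 subr_eq0 => /eqP.
Qed.

Lemma pointwise_limit (T : nat -> bop H H) :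
  (forall x, exists l, hlim (fun k => T k x) l) ->
  (forall k x, hnorm (T k x) <= hnorm x) ->
  exists2 S : bop H H, forall x, hlim (fun k => T k x) (S x) &
    forall x, hnorm (S x) <= hnorm x.
Proof.
move=> /boolp.choice[S ST] T1.
have S1 x : hnorm (S x) <= hnorm x.
  by apply: (ler_cvg_to (hlim_hnorm (ST x)) (@cvg_cst _ _ _ _ _)); apply: nearW.
have Sb : bounded_linear S.
  split=> [a x y|]; last by exists 1 => x; rewrite mul1r.
  apply: (hlim_uniq (ST _)); rewrite (_ : (fun k => _) =
    (fun k => a *: T k x) \+ (fun k => T k y)).
    by apply: hlimD => //; apply: hlimZ.
  by apply: funext => k /=; rewrite linearP.
by exists (mkbop Sb).
Qed.

Variable Q : bop H H.
Hypothesis Qsa : forall x y, hdot (Q x) y = hdot x (Q y).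
Hypothesis Q1 : forall x, hnorm (Q x) <= hnorm x.

(* If Y = (Q + Y^2) / 2 then (1 - Y)^2 = 1 - Q; the fixed point is reached by
   iterating from 0, with the iterates of the scalar equation for Q = 1 as
   majorants. *)
Let Y := fix Y k : bop H H :=
  if k is k'.+1 then 2^-1%:C *: (Q + Y k' \ob Y k') else 0.
Let y := fix y k : R := if k is k'.+1 then 2^-1 * (1 + y k' ^+ 2) else 0.

Let y01 k : 0 <= y k <= 1.
Proof. by elim: k => [|k /andP[IH0 IH1]] /=; first rewrite lexx ler01 //; nra. Qed.

Let y_incr k : y k <= y k.+1.
Proof. by have /andP[_ ?] := y01 k; rewrite /=; nra. Qed.

Let YS k x : Y k.+1 x = 2^-1%:C *: (Q x + Y k (Y k x)).
Proof. by []. Qed.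

Let Y_norm k x : hnorm (Y k x) <= y k * hnorm x.
Proof.
elim: k x => [|k IH] x; first by rewrite hnorm0 mul0r.
rewrite YS hnormZr ?invr_ge0 //= -mulrA ler_pM2l ?invr_gt0 //.
apply: le_trans (hnorm_triangle _ _) _; rewrite mulrDl mul1r lerD //.
have /andP[y0 _] := y01 k.
by apply: le_trans (IH _) _; rewrite expr2 -mulrA ler_wpM2l.
Qed.

(** Twice the next increment is [Y_(k+1) (Y_(k+1) - Y_k) + (Y_(k+1) - Y_k) Y_k]; the scalar
    increments satisfy the same recursion, so they majorise. *)
Let Y_step k x : hnorm (Y k.+1 x - Y k x) <= (y k.+1 - y k) * hnorm x.
Proof.
elim: k x => [|k IH] x.
  rewrite YS (_ : Y 0%N x = 0) // (_ : Y 0%N 0 = 0) // subr0 addr0.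
  by rewrite hnormZr ?invr_ge0 //= expr0n addr0 mulr1 subr0 ler_pM2l ?invr_gt0.
rewrite !YS -scalerBr hnormZr ?invr_ge0 //.
have -> : Q x + Y k.+1 (Y k.+1 x) - (Q x + Y k (Y k x)) =
    Y k.+1 (Y k.+1 x - Y k x) + (Y k.+1 (Y k x) - Y k (Y k x)).
  by rewrite linearB /= addrA subrK [Q x + _]addrC opprD addrA addrK.
have -> : y k.+2 - y k.+1 = 2^-1 * ((y k.+1 + y k) * (y k.+1 - y k)).
  have e1 : y k.+2 = 2^-1 * (1 + y k.+1 ^+ 2) by [].
  have e2 : y k.+1 = 2^-1 * (1 + y k ^+ 2) by [].
  by move: e1 e2; move: (y k.+2) (y k.+1) (y k) => c a b -> ->; field.
rewrite -mulrA ler_pM2l ?invr_gt0 //; apply: le_trans (hnorm_triangle _ _) _.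
have /andP[y0 _] := y01 k.+1; have /andP[y0' _] := y01 k.
rewrite -mulrA mulrDl lerD //.
  by apply: le_trans (Y_norm _ _) _; rewrite ler_wpM2l.
by apply: le_trans (IH _) _; rewrite mulrCA ler_wpM2l // subr_ge0 y_incr.
Qed.

Let Y_cauchy p q x : hnorm (Y p x - Y q x) <= `|y p - y q| * hnorm x.
Proof.
wlog pq : p q / (p <= q)%N => [h|].
  by have [/h//|/ltnW/h] := leqP p q; rewrite hnormBC distrC.
suff : hnorm (Y q x - Y p x) <= (y q - y p) * hnorm x.
  rewrite hnormBC distrC => /le_trans; apply.
  by rewrite ler_wpM2r ?hnorm_ge0 // ler_norm.
rewrite -(subnKC pq); elim: (q - p)%N => [|k IH].
  by rewrite addn0 !subrr hnorm0 mul0r.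
rewrite addnS; apply: le_trans (hnormB3 _ (Y (p + k) x) _) _.
have := Y_step (p + k) x; have := hnorm_ge0 x; lra.
Qed.

Lemma sqrt_exists : exists2 S : bop H H, opsd S & S \ob S = bid H - Q.
Proof.
have ycvg : cvgn y.
  apply: nondecreasing_is_cvgn; first by apply/nondecreasing_seqP.
  by exists 1 => _ [k _ <-]; have /andP[] := y01 k.
have [x||Z YZ Z1] := @pointwise_limit Y.
- apply: hcauchy_lim => e e0; have d0 : 0 < e / (hnorm x + 1) / 2.
    by rewrite !divr_gt0 // ltr_wpDl ?hnorm_ge0.
  have /cvgrPdist_lt/(_ _ d0)[N _ NP] := ycvg.
  exists N => p q pN qN; apply: le_lt_trans (Y_cauchy _ _ _) _.
  have := NP p pN; have := NP q qN; set l := lim _ => /= hq hp.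
  have h : `|y p - y q| < e / (hnorm x + 1).
    have -> : y p - y q = (l - y q) - (l - y p) by ring.
    by apply: le_lt_trans (ler_normB _ _) _; lra.
  have x0 := hnorm_ge0 x.
  apply: (@le_lt_trans _ _ (`|y p - y q| * (hnorm x + 1))).
    by rewrite ler_wpM2l // lerDl.
  by rewrite -ltr_pdivlMr // ltr_wpDl.
- move=> k x; apply: le_trans (Y_norm _ _) _; have /andP[_ ?] := y01 k.
  by rewrite ler_piMl ?hnorm_ge0.
have Ysa k u v : hdot (Y k u) v = hdot u (Y k v).
  elim: k u v => [|k IH] u v; first by rewrite hdot0l hdot0r.
  rewrite !YS hdotZl hdotZr hdotDl hdotDr Qsa !IH.
  by congr (_ * _); apply: complex_eq => //=; rewrite oppr0.
have Zsa u v : hdot (Z u) v = hdot u (Z v).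
  move: u; apply: hdot_real_eq => [a u|a u|u]; rewrite ?linearZ ?hdotZl //.
  rewrite (hdot_herm u) Re_conj.
  have c1 := hlim_Re_dot (y := v) (YZ u); have c2 := hlim_Re_dot (y := u) (YZ v).
  rewrite -(cvg_lim _ c1) // -(cvg_lim _ c2) //.
  by congr (limn _); apply: funext => k; rewrite Ysa (hdot_herm u) Re_conj.
(* Limit of [2 Y_(k+1) = Q + Y_k^2]. For the square, split [Y_k Y_k x - Z Z x] as
   [Y_k (Y_k x - Z x) + (Y_k - Z) (Z x)] and use that every [Y_k] is a contraction. *)
have ZE x : Z x + Z x = Q x + Z (Z x).
  have h : hlim (fun k => Y k (Y k x)) (Z (Z x)).
    apply: (@hlim_le _ _ _ _ (fun k => hnorm (Y k x - Z x) + hnorm (Y k (Z x) - Z (Z x)))).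
      move=> k; apply: le_trans (hnormB3 _ (Y k (Z x)) _) _; rewrite lerD2r -linearB.
      apply: le_trans (Y_norm _ _) _; have /andP[_ ?] := y01 k.
      by rewrite ler_piMl ?hnorm_ge0.
    by rewrite -[X in _ --> X](addr0 0); apply: cvgD; apply: YZ.
  apply: (@hlim_uniq _ _ (fun k => Y k.+1 x + Y k.+1 x)).
    by apply: hlimD; apply: hlim_shift (YZ x).
  rewrite (_ : (fun k => _) = fun k => Q x + Y k (Y k x)).
    by apply: hlimD => //; apply: hlim_cst.
  apply: funext => k; rewrite !YS -scalerDl.
  rewrite (_ : _%:C + _ = 1) ?scale1r //.
  by apply: complex_eq; rewrite /=; field.
(* The root is [1 - Z]: positive since [Z] is a self-adjoint contraction, with square
   [1 - 2 Z + Z^2 = 1 - Q]. *)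
exists (bid H - Z) => [x|].
  rewrite (_ : (bid H - Z) x = x - Z x) // hdotBl hdotxx lecE ImD ImN /=.
  have : complex.Im (hdot (Z x) x) = 0.
    by have /(congr1 (@complex.Im R)) := Zsa x x; rewrite (hdot_herm x) Im_conj; lra.
  move=> ->; rewrite subrr eqxx /= ReD ReN /= -sqr_hnorm subr_ge0.
  apply: le_trans (ler_norm _) _; apply: le_trans (Re_hdot_hnorm _ _) _.
  by rewrite expr2 ler_wpM2r ?hnorm_ge0.
apply: bop_ext => x.
rewrite (_ : ((bid H - Z) \ob (bid H - Z)) x = (x - Z x) - Z (x - Z x)) //.
rewrite (_ : (bid H - Q) x = x - Q x) // linearB opprB /=.
have -> : Z (Z x) = Z x + Z x - Q x by rewrite ZE addrAC subrr add0r.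
by rewrite (addrAC (Z x + Z x)) addrK addrA subrK.
Qed.

End SquareRoot.

(** * Extension of densely defined operators *)

Section Extension.
Variables (R : realType) (H K : hilbertType R).

(** [G] is the graph of a bounded operator on a dense subspace. A relation is used because its
    elements will have many representations; the bound, applied to differences, makes [G]
    single-valued and lets it extend by continuity. *)
Lemma linear_relation_extension (G : H -> K -> Prop) (c : R) : 0 <= c ->
  (forall (a : R[i]) x y x' y', G x y -> G x' y' -> G (a *: x + x') (a *: y + y')) ->
  (forall x y, G x y -> hnorm y <= c * hnorm x) ->
  (forall x e, 0 < e -> exists x' y', G x' y' /\ hnorm (x - x') < e) ->
  exists2 L : bop H K, (forall x y, G x y -> L x = y) &
    forall x, hnorm (L x) <= c * hnorm x.
Proof.
move=> c0 Glin Gle Gdense.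
have Gsub x y x' y' : G x y -> G x' y' -> hnorm (y - y') <= c * hnorm (x - x').
  move=> Gxy Gxy'; have := Glin (-1) _ _ _ _ Gxy' Gxy.
  by rewrite !scaleN1r !(addrC (- _)); apply: Gle.
have approx x : exists u : nat -> H * K, (forall k, G (u k).1 (u k).2) /\
    hlim (fun k => (u k).1) x.
  have /boolp.choice[u uP] : forall k : nat, exists p : H * K,
      G p.1 p.2 /\ hnorm (x - p.1) < k.+1%:R^-1.
    move=> k; have [|x' [y' xy']] := Gdense x k.+1%:R^-1; first by rewrite invr_gt0.
    by exists (x', y').
  exists u; split=> [k|]; first by have [] := uP k.
  apply: hlim_le (@cvg_harmonic R) => k; rewrite hnormBC.
  by have [_ /ltW] := uP k.
have /boolp.choice[u uP] := approx.
have Lex x : exists l, hlim (fun k => (u x k).2) l.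
  have [Gu /hlimP ux] := uP x; apply: hcauchy_lim => e e0.
  have d0 : 0 < e / (c + 1) / 2 by rewrite !divr_gt0 // ltr_wpDl.
  have [N NP] := ux _ d0; exists N => p q pN qN.
  apply: le_lt_trans (Gsub _ _ _ _ (Gu p) (Gu q)) _.
  have := NP p pN; have := NP q qN; rewrite (hnormBC _ x) => hq hp.
  have h : hnorm ((u x p).1 - (u x q).1) < e / (c + 1).
    by apply: le_lt_trans (hnormB3 _ x _) _; rewrite (hnormBC x) in hq *; lra.
  apply: (@le_lt_trans _ _ ((c + 1) * hnorm ((u x p).1 - (u x q).1))).
    by rewrite ler_wpM2r ?hnorm_ge0 // lerDl.
  by rewrite mulrC -ltr_pdivlMr // ltr_wpDl.
have /boolp.choice[L LP] := Lex.
(* The limit is the same for every approximating sequence in [G], not only for the chosen one;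
   linearity follows. *)
have Llim x (v : nat -> H * K) : (forall k, G (v k).1 (v k).2) ->
    hlim (fun k => (v k).1) x -> hlim (fun k => (v k).2) (L x).
  move=> Gv vx; have [Gu ux] := uP x.
  apply: (@hlim_le _ _ _ _ (fun k => c * (hnorm ((v k).1 - x) + hnorm ((u x k).1 - x))
      + hnorm ((u x k).2 - L x))).
    move=> k; apply: le_trans (hnormB3 _ (u x k).2 _) _; rewrite lerD2r.
    apply: le_trans (Gsub _ _ _ _ (Gv k) (Gu k)) _; rewrite ler_wpM2l //.
    by rewrite (hnormBC (u x k).1) hnormB3.
  rewrite -[X in _ --> X](addr0 0); apply: cvgD (LP x).
  apply: cvg0Mr; rewrite -[X in _ --> X](addr0 0); exact: cvgD.
have LG x y : G x y -> L x = y.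
  move=> Gxy; apply: (hlim_uniq (Llim x (fun=> (x, y)) _ _)) => //; exact: hlim_cst.
have Lle x : hnorm (L x) <= c * hnorm x.
  have [Gu ux] := uP x.
  have cc : c * hnorm (u x k).1 @[k --> \oo] --> c * hnorm x.
    by apply: cvgMl_tmp; apply: hlim_hnorm.
  apply: (ler_cvg_to (hlim_hnorm (LP x)) cc).
  by apply: nearW => k; apply: Gle.
have Lb : bounded_linear L.
  split=> [a x y|]; last by exists c.
  have [Gx ux] := uP x; have [Gy uy] := uP y.
  apply: (hlim_uniq (Llim _ (fun k => (a *: (u x k).1 + (u y k).1,
     a *: (u x k).2 + (u y k).2)) _ _)) => [k||] /=.
  - exact: Glin.
  - by apply: hlimD => //; apply: hlimZ.
  - by apply: hlimD => //; apply: hlimZ.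
by exists (mkbop Lb).
Qed.

End Extension.

(** * The minimal isometric dilation *)

Section FockDot.
Variables (R : realType) (n : nat) (D : hilbertType R).
Implicit Types x y : fock n D.

Lemma limn_series_shift (f g : nat -> R) : cvgn (series g) ->
  f 0%N = 0 -> (forall k, f k.+1 = g k) -> limn (series f) = limn (series g).
Proof.
move=> cg f0 fS; apply/cvg_lim => //; rewrite -cvg_shiftS.
rewrite (_ : [sequence _]_k = series g) //.
apply: funext => k /=; rewrite /series /= big_nat_recl // f0 add0r.
by apply: eq_bigr => j _; rewrite fS.
Qed.

(** Creation operators raise the degree by one, so their inner products are compared with a shift of
    the degree. *)
Lemma fock_dot_shift x y x' y' : degree_dot x y 0 = 0 ->
  (forall k, degree_dot x y k.+1 = degree_dot x' y' k) -> hdot x y = hdot x' y'.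
Proof.
move=> d0 dS; rewrite /hdot /= /fock_dot; congr (_ +i* _); apply: limn_series_shift.
- exact: cvg_Re_dot.
- by rewrite d0.
- by move=> k; rewrite dS.
- exact: cvg_Im_dot.
- by rewrite d0.
- by move=> k; rewrite dS.
Qed.

Lemma fock_dot_vacuum x y : (forall k, degree_dot x y k.+1 = 0) ->
  hdot x y = degree_dot x y 0.
Proof.
move=> dS; have E (f : nat -> R) : (forall k, f k.+1 = 0) -> limn (series f) = f 0%N.
  move=> fS; apply/cvg_lim => //; rewrite -cvg_shiftS.
  rewrite (_ : [sequence _]_k = fun=> f 0%N); first exact: cvg_cst.
  by apply: funext => k /=; rewrite /series /= big_nat_recl // big1 ?addr0.
rewrite /hdot /= /fock_dot !E => [|k|k]; rewrite ?dS //.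
by apply: complex_eq.
Qed.

Lemma big_tupleS (T : finType) (V : nmodType) (k : nat) (F : seq T -> V) :
  \sum_(w : k.+1.-tuple T) F w = \sum_a \sum_(w : k.-tuple T) F (a :: w).
Proof.
rewrite pair_big /= (reindex (fun p : T * k.-tuple T => [tuple of p.1 :: p.2])) //=.
exists (fun w => (thead w, [tuple of behead w])) => [[a w] _|w _] /=.
  by rewrite theadE; congr pair; apply: val_inj.
by case/tupleP: w => a w; rewrite theadE; apply: val_inj.
Qed.

Lemma degree_dotS (x y : seq 'I_n -> D) k : degree_dot x y k.+1 =
  \sum_a \sum_(w : k.-tuple 'I_n) hdot (x (a :: w)) (y (a :: w)).
Proof. exact: (big_tupleS _ (fun u => hdot (x u) (y u))). Qed.

Lemma hdot_vacuum (d e : D) : hdot (vacuum n D d) (vacuum n D e) = hdot d e.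
Proof.
rewrite fock_dot_vacuum => [|k].
  by rewrite /degree_dot (big_pred1 [tuple]) // => w; apply/esym/eqP/tuple0.
by rewrite degree_dotS; apply: big1 => a _; apply: big1 => w _; rewrite hdot0l.
Qed.

Lemma hdot_creation i j x y :
  hdot (creation D i x) (creation D j y) = (i == j)%:R * hdot x y.
Proof.
have E0 : degree_dot (creation D i x) (creation D j y) 0 = 0.
  by apply: big1 => w _; rewrite tuple0 hdot0l.
have ES k : degree_dot (creation D i x) (creation D j y) k.+1 =
    (i == j)%:R * degree_dot x y k.
  rewrite degree_dotS (bigD1 i) //= eqxx [X in _ + X]big1 ?addr0 => [|a ai].
    by case: eqP => _; rewrite ?mul1r // mul0r big1 // => w _; rewrite hdot0r.
  by apply: big1 => w _; rewrite (negPf ai) hdot0l.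
case: eqP ES => [_|_] ES.
  by rewrite mul1r; apply: fock_dot_shift => // k; rewrite ES mul1r.
rewrite mul0r -(hdot0l y); apply: fock_dot_shift => // k.
by rewrite ES mul0r; apply/esym/big1 => w _; rewrite hdot0l.
Qed.

Lemma hdot_creation_vacuum i x d : hdot (creation D i x) (vacuum n D d) = 0.
Proof.
rewrite fock_dot_vacuum => [|k].
  by apply: big1 => w _; rewrite tuple0 hdot0l.
by rewrite degree_dotS; apply: big1 => a _; apply: big1 => w _; rewrite hdot0r.
Qed.

Definition basis_vec (w : seq 'I_n) (d : D) : fock n D :=
  foldr (fun i => creation D i) (vacuum n D d) w.

Lemma basis_vecE w d u : basis_vec w d u = if u == w then d else 0.
Proof.
elim: w u => [|i w IH] [|j u] //=; rewrite eqseq_cons.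
by case: eqP => _ //=; rewrite IH.
Qed.

Definition trunc (k : nat) x : fock n D :=
  \sum_(j < k) \sum_(w : j.-tuple 'I_n) basis_vec w (x w).

Lemma fock_sumE (I : Type) (r : seq I) (P : pred I) (F : I -> fock n D) u :
  (\sum_(i <- r | P i) F i) u = \sum_(i <- r | P i) F i u.
Proof. by elim/big_rec2: _ => // i y z _ <-. Qed.

Lemma truncE k x u : trunc k x u = if (size u < k)%N then x u else 0.
Proof.
rewrite /trunc fock_sumE; case: ltnP => uk.
  rewrite (bigD1 (Ordinal uk)) //= fock_sumE (bigD1 (in_tuple u)) //= basis_vecE eqxx.
  rewrite big1 => [|w wu]; last first.
    by rewrite basis_vecE ifN //; apply: contraNneq wu => uw; apply/eqP/val_inj.
  rewrite addr0 big1 ?addr0 // => j ju; rewrite fock_sumE big1 // => w _.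
  rewrite basis_vecE ifN //; apply: contraNneq ju => uw; apply/eqP/val_inj => /=.
  by rewrite uw size_tuple.
rewrite big1 // => j _; rewrite fock_sumE big1 // => w _.
rewrite basis_vecE ifN //; apply/negP => /eqP uw; move: uk.
by rewrite uw size_tuple leqNgt ltn_ord.
Qed.

(** The square norm of the remainder is bounded by a tail of the convergent series for [sqn x]. *)
Lemma trunc_lim x : hlim (trunc^~ x) x.
Proof.
have Ed k j : degree_sqn (x - trunc k x) j = if (j < k)%N then 0 else degree_sqn x j.
  rewrite /degree_sqn; case: ifP => jk; [apply: big1|apply: eq_bigr] => w _;
    rewrite (_ : (x - trunc k x) w = x w - trunc k x w) // truncE size_tuple jk.
  - by rewrite subrr sqn0.
  - by rewrite subr0.
have Es k m : series (degree_sqn (x - trunc k x)) m =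
    series (degree_sqn x) m - series (degree_sqn x) (minn k m).
  rewrite /series /=; elim: m => [|m IH]; first by rewrite minn0 !big_geq // subrr.
  rewrite !big_nat_recr //= IH Ed; case: ltnP => km.
    by rewrite (minn_idPr km) !big_nat_recr //= !subrr addr0.
  by rewrite (minn_idPl (leqW km)) addrAC.
have le k : sqn (x - trunc k x) <= sqn x - series (degree_sqn x) k.
  apply: fock_sqn_le => m; rewrite Es; case: (leqP k m) => km.
    by rewrite lerD2r series_sqn_le.
  by rewrite subrr subr_ge0 series_sqn_le.
have c : sqn x - series (degree_sqn x) k @[k --> \oo] --> (0 : R).
  rewrite -(subrr (sqn x)); apply: cvgB; first exact: cvg_cst.
  by rewrite /sqn fock_sqnE; apply: cvg_sqn.
apply/hlimP => e e0; have [N _ NP] := cvgr_lt _ c _ (exprn_gt0 2 e0).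
exists N => p pN; rewrite hnormBC /hnorm sqrt_lt //.
exact: le_lt_trans (le _) (NP p pN).
Qed.

End FockDot.

Section DilationIsometry.
Variables (R : realType) (n : nat) (H : hilbertType R).
Variable T : 'I_n -> bop H H.
Hypothesis T1 : row_le T 1.

Lemma row_le_adj y : \sum_i sqn (adj (T i) y) <= sqn y.
Proof.
have := T1 (fun i => adj (T i) y); rewrite mul1r => h.
have := row_adj_dot T y; rewrite bop_sumE /=; set z := \sum_i T i _ => e.
have := sqn_ge0 (z - y); rewrite sqnB -e; rewrite -/z in h; lra.
Qed.

Let Q : bop {ffun 'I_n -> H} {ffun 'I_n -> H} :=
  opmx (\matrix_(i < n, j < n) (adj (T i) \ob T j)).

Let QE f i : Q f i = adj (T i) (\sum_j T j (f j)).
Proof. by rewrite ffunE linear_sum; apply: eq_bigr => j _; rewrite mxE. Qed.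

Let Q_dot f g : hdot (Q f) g = hdot (\sum_j T j (f j)) (\sum_j T j (g j)).
Proof.
rewrite hdot_sumr; apply: eq_bigr => i _.
by rewrite QE -adjPr.
Qed.

(** [Q] is [T^* T] for the row [T], a self-adjoint contraction, so [1 - Q] has a positive root and
    [sqrtop] selects one. The second clause is [<Delta f, Delta g> = <f, (1 - Q) g>]. *)
Lemma defect_opP : opsd (defect_op T) /\
  forall f g, hdot (defect_op T f) (defect_op T g) =
    hdot f g - hdot (\sum_j T j (f j)) (\sum_j T j (g j)).
Proof.
have Qsa f g : hdot (Q f) g = hdot f (Q g).
  by rewrite (hdot_herm f) !Q_dot -hdot_herm.
have Q1 f : hnorm (Q f) <= hnorm f.
  rewrite -[leRHS]mul1r hnorm_le_sqn // expr1n.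
  have : sqn (Q f) <= sqn f.
    rewrite [leLHS]sqn_ffun [leRHS]sqn_ffun.
    under eq_bigr do rewrite QE.
    by apply: le_trans (row_le_adj _) _; rewrite -[leRHS]mul1r.
  by rewrite mul1r.
have QP : bid _ - Q = opmx (\matrix_(i < n, j < n)
    (((i == j)%:R : R[i]) *: bid H - adj (T i) \ob T j)).
  apply: bop_ext => f; apply/ffunP => i; rewrite [RHS]ffunE.
  rewrite (_ : (bid _ - Q) f i = f i - Q f i); last by rewrite !ffunE.
  rewrite QE linear_sum -{1}[f i](_ : \sum_j (i == j)%:R *: f j = _); last first.
    rewrite (bigD1 i) //= eqxx scale1r big1 ?addr0 // => j ji.
    by rewrite eq_sym (negPf ji) scale0r.
  by rewrite -sumrB; apply: eq_bigr => j _; rewrite mxE.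
have [S S0 SS] := sqrt_exists Qsa Q1.
have [D0 DD] : opsd (defect_op T) /\ defect_op T \ob defect_op T = bid _ - Q.
  have ex : exists S, [set S : bop _ _ | opsd S /\ S \ob S = bid _ - Q] S by exists S.
  by rewrite /defect_op -QP; exact: (xgetPex 0 ex).
split=> // f g; rewrite (opsd_selfadj D0).
have -> : defect_op T (defect_op T g) = g - Q g.
  by rewrite -[LHS]/((defect_op T \ob defect_op T) g) DD.
by rewrite hdotBr -Qsa Q_dot.
Qed.

Notation V := (dilation T).
Notation D := (defect_space T).

Lemma sum_place (X : 'I_n -> bop H H) i h :
  \sum_j X j (place H i h j) = X i h.
Proof.
rewrite (bigD1 i) //= ffunE eqxx big1 ?addr0 // => j ji.
by rewrite ffunE (negPf ji) linear0.
Qed.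

Lemma hdot_defect_col i j h k : hdot (defect_col T i h) (defect_col T j k) =
  (i == j)%:R * hdot h k - hdot (T i h) (T j k).
Proof.
rewrite /defect_col /= hdot_vacuum; have [_ DD] := defect_opP.
rewrite -[LHS]/(hdot (defect_op T (place H i h)) (defect_op T (place H j k))).
rewrite DD !sum_place; congr (_ - _).
rewrite /hdot /= /ffun_dot (bigD1 i) //= !ffunE eqxx big1 ?addr0 => [|l li].
  by case: eqP => _; rewrite ?mul1r // hdot0r mul0r.
by rewrite ffunE (negPf li) hdot0l.
Qed.

(** The defect columns supply exactly what [<T_i h, T_j k>] lacks to reach [delta_ij <h, k>], and
    creation ranges are orthogonal to the vacuum. *)
Lemma dilation_isometry i j (x y : dilation_space T) :
  hdot (V i x) (V j y) = (i == j)%:R * hdot x y.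
Proof.
rewrite -[LHS]/(hdot (T i x.1) (T j y.1) + hdot (defect_col T i x.1 + creation D i x.2)
  (defect_col T j y.1 + creation D j y.2)).
rewrite hdotDl !hdotDr hdot_defect_col hdot_creation hdot_creation_vacuum.
rewrite (hdot_herm (defect_col T i x.1)) hdot_creation_vacuum rmorph0 add0r addr0.
by rewrite -[hdot x y]/(hdot x.1 y.1 + hdot x.2 y.2); ring.
Qed.

Lemma dilation_inl i h : V i (h, 0) = (T i h, defect_col T i h).
Proof.
rewrite -[LHS]/(T i h, defect_col T i h + creation D i 0).
by rewrite linear0 addr0.
Qed.

Lemma dilation_inr i xi : V i (0, xi) = (0, creation D i xi).
Proof.
rewrite -[LHS]/(T i 0, defect_col T i 0 + creation D i xi).
by rewrite !linear0 add0r.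
Qed.

Lemma hnorm_dilation i (x : dilation_space T) : hnorm (V i x) = hnorm x.
Proof. by rewrite /hnorm /sqn /sqn_of dilation_isometry eqxx mul1r. Qed.

Lemma dilation_monomial_fst w (x : dilation_space T) :
  (monomial V w x).1 = monomial T w x.1.
Proof. by elim: w => //= i w ->. Qed.

(* A word may occur several times in s, so that sums and multiples of orbit
   sums are again orbit sums, by concatenation and scaling of lists. *)
Definition orbit_sum (s : seq (seq 'I_n * H)) : dilation_space T :=
  \sum_(p <- s) monomial V p.1 (p.2, 0).

Definition orbit_closure (x : dilation_space T) : Prop :=
  forall e : R, 0 < e -> exists s, hnorm (x - orbit_sum s) < e.

Lemma orbit_sum_cat s t : orbit_sum (s ++ t) = orbit_sum s + orbit_sum t.
Proof. exact: big_cat. Qed.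

Lemma orbit_sumZ (a : R[i]) s :
  orbit_sum [seq (p.1, a *: p.2) | p <- s] = a *: orbit_sum s.
Proof.
rewrite /orbit_sum big_map scaler_sumr; apply: eq_bigr => p _ /=.
rewrite -linearZ; congr (monomial _ _ _).
by congr pair; rewrite scaler0.
Qed.

Lemma orbit_sum_dilation i s :
  orbit_sum [seq (i :: p.1, p.2) | p <- s] = V i (orbit_sum s).
Proof. by rewrite /orbit_sum big_map linear_sum. Qed.

Lemma orbit_closure_orbit s : orbit_closure (orbit_sum s).
Proof. by move=> e e0; exists s; rewrite subrr hnorm0. Qed.

Lemma orbit_closure_lim x :
  (forall e, 0 < e -> exists2 y, orbit_closure y & hnorm (x - y) < e) ->
  orbit_closure x.
Proof.
move=> xP e e0; have e20 : 0 < e / 2 by rewrite divr_gt0.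
have [y yP xy] := xP _ e20; have [s ys] := yP _ e20.
by exists s; apply: le_lt_trans (hnormB3 _ y _) _; lra.
Qed.

Lemma orbit_closureP (a : R[i]) x y :
  orbit_closure x -> orbit_closure y -> orbit_closure (a *: x + y).
Proof.
move=> xP yP e e0; set r := Num.sqrt (complex.Re a ^+ 2 + complex.Im a ^+ 2).
have r0 : 0 <= r := sqrtr_ge0 _; have r1 : 0 < r + 1 by rewrite ltr_wpDl.
have [s xs] := xP (e / 2 / (r + 1)) (divr_gt0 (divr_gt0 e0 (ltr0n _ 2)) r1).
have [t yt] := yP _ (divr_gt0 e0 (ltr0n _ 2)).
exists ([seq (p.1, a *: p.2) | p <- s] ++ t).
rewrite orbit_sum_cat orbit_sumZ opprD addrACA -scalerBr.
apply: le_lt_trans (hnorm_triangle _ _) _; rewrite hnormZ -/r.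
have h : (r + 1) * hnorm (x - orbit_sum s) < e / 2 by rewrite mulrC -ltr_pdivlMr.
have h2 : r * hnorm (x - orbit_sum s) <= (r + 1) * hnorm (x - orbit_sum s).
  by rewrite ler_wpM2r ?hnorm_ge0 // lerDl.
by rewrite [ltRHS](splitr e); apply: ltrD yt; apply: le_lt_trans h2 h.
Qed.

Lemma orbit_closure0 : orbit_closure 0.
Proof. by move=> e e0; exists [::]; rewrite /orbit_sum big_nil subr0 hnorm0. Qed.

Lemma orbit_closureD x y : orbit_closure x -> orbit_closure y -> orbit_closure (x + y).
Proof. by move=> xP yP; rewrite -[x]scale1r; apply: orbit_closureP. Qed.

Lemma orbit_closureN x : orbit_closure x -> orbit_closure (- x).
Proof.
move=> xP; rewrite -scaleN1r -[X in orbit_closure X]addr0.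
exact: orbit_closureP orbit_closure0.
Qed.

Lemma orbit_closure_sum (I : Type) (r : seq I) (P : pred I) F :
  (forall i, P i -> orbit_closure (F i)) -> orbit_closure (\sum_(i <- r | P i) F i).
Proof.
move=> FP; elim/big_ind: _ => [|x y|i /FP //].
  exact: orbit_closure0.
exact: orbit_closureD.
Qed.

Lemma orbit_closure_inl (h : H) : orbit_closure (h, 0).
Proof.
rewrite (_ : (h, 0) = orbit_sum [:: ([::], h)]); first exact: orbit_closure_orbit.
by rewrite /orbit_sum big_seq1.
Qed.

Lemma orbit_closure_dilation i x : orbit_closure x -> orbit_closure (V i x).
Proof.
move=> xP e /xP[s xs]; exists [seq (i :: p.1, p.2) | p <- s].
by rewrite orbit_sum_dilation -linearB hnorm_dilation.
Qed.

Lemma hnorm_inr (xi : fock n D) : hnorm ((0, xi) : dilation_space T) = hnorm xi.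
Proof. by rewrite /hnorm [sqn _]sqn_pair sqn0 add0r. Qed.

(** Since [V_i h - T_i h] is the [i]-th defect column of [h], summing over [i] produces
    [1 (x) Delta f]; these vectors are dense in [1 (x) D]. *)
Lemma orbit_closure_vacuum (d : D) : orbit_closure (0, vacuum n D d).
Proof.
have range f : orbit_closure (0, vacuum n D (to_defect T f)).
  rewrite (_ : (0, _) = \sum_i (V i (f i, 0) - (T i (f i), 0)) :> dilation_space T).
    apply: orbit_closure_sum => i _; apply: orbit_closureD.
      exact: orbit_closure_dilation (orbit_closure_inl _).
    exact: orbit_closureN (orbit_closure_inl _).
  have fE : f = \sum_i place H i (f i).
    apply/ffunP => j; rewrite sum_ffunE (bigD1 j) //= ffunE eqxx big1 ?addr0 // => i ij.
    by rewrite ffunE eq_sym (negPf ij).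
  rewrite {1}fE !linear_sum -[LHS]/(inr_op H (fock n D) _) linear_sum.
  apply: eq_bigr => i _; rewrite dilation_inl.
  rewrite -[RHS]/(T i (f i) - T i (f i), defect_col T i (f i) - 0).
  by rewrite subrr subr0.
apply: orbit_closure_lim => e e0.
have /asboolP/(_ _ e0)[f df] := (valP d).
exists (0, vacuum n D (to_defect T f)); first exact: range.
have -> : ((0, vacuum n D d) - (0, vacuum n D (to_defect T f)) : dilation_space T) =
    (0, vacuum n D (d - to_defect T f)).
  by rewrite linearB; congr pair; rewrite subrr.
by rewrite hnorm_inr /hnorm /sqn /sqn_of hdot_vacuum.
Qed.

(** Minimality of the dilation: applying the [V_i] to vacuum vectors gives every [e_w (x) d], and
    truncations approximate the rest. *)
Lemma orbit_dense x : orbit_closure x.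
Proof.
case: x => h xi.
have basis w d : orbit_closure (0, basis_vec w d).
  elim: w => [|i w IH]; first exact: orbit_closure_vacuum.
  rewrite -[basis_vec _ _]/(creation D i (basis_vec w d)) -dilation_inr.
  exact: orbit_closure_dilation.
rewrite (_ : (h, xi) = (h, 0) + (0, xi)); last by congr pair; rewrite ?addr0 ?add0r.
apply: orbit_closureD; first exact: orbit_closure_inl.
apply: orbit_closure_lim => e e0; have /hlimP/(_ e e0)[N NP] := trunc_lim xi.
exists (0, trunc N xi).
  rewrite (_ : (0, _) = \sum_(j < N) \sum_(w : j.-tuple 'I_n) (0, basis_vec w (xi w))
    :> dilation_space T).
    by apply: orbit_closure_sum => j _; apply: orbit_closure_sum => w _.
  rewrite -[LHS]/(inr_op H (fock n D) (trunc N xi)) linear_sum; apply: eq_bigr => j _.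
  by rewrite linear_sum.
rewrite (_ : _ - _ = (0, xi - trunc N xi)); last by congr pair; rewrite subrr.
by rewrite hnorm_inr hnormBC NP.
Qed.

End DilationIsometry.

(** [T_w] is the compression of [V_w] to [H], because every [V_i] is lower triangular. *)
Lemma hdot_monomial_inl (R : realType) (n : nat) (H : hilbertType R)
    (T : 'I_n -> bop H H) w (h k : H) :
  hdot (monomial (dilation T) w (k, 0)) (h, 0) = hdot (monomial T w k) h.
Proof.
set x := monomial (dilation T) w (k, 0).
rewrite -[LHS]/(hdot x.1 h + hdot x.2 0) hdot0r addr0.
by rewrite /x dilation_monomial_fst.
Qed.

(** * Intertwiners from Harnack domination *)

Section IntertwinerUnique.
Variables (R : realType) (n : nat) (H : hilbertType R).
Implicit Types A B : 'I_n -> bop H H.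

Definition intertwiner B A (L : bop (dilation_space B) (dilation_space A)) : Prop :=
  (forall h : H, L (h, 0) = (h, 0)) /\
  (forall i, L \ob dilation B i = dilation A i \ob L).

Lemma intertwiner_monomial B A L w x : intertwiner L ->
  L (monomial (dilation B) w x) = monomial (dilation A) w (L x).
Proof.
move=> [_ LV]; elim: w => //= i w <-.
by rewrite -[LHS]/((L \ob dilation B i) _) LV.
Qed.

Lemma intertwiner_orbit_sum B A (L : bop (dilation_space B) (dilation_space A)) s :
  intertwiner L -> L (orbit_sum B s) = orbit_sum A s.
Proof.
move=> LP; rewrite /orbit_sum linear_sum; apply: eq_bigr => p _ /=.
by rewrite intertwiner_monomial // LP.1.
Qed.

Lemma dense_bop_eq (X : hilbertType R) B (S S' : bop (dilation_space B) X) :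
  row_le B 1 -> (forall s, S (orbit_sum B s) = S' (orbit_sum B s)) -> S = S'.
Proof.
move=> B1 SS'; apply: bop_ext => x.
have /boolp.choice[u uP] : forall k : nat, exists s, hnorm (x - orbit_sum B s) < k.+1%:R^-1.
  by move=> k; apply: orbit_dense => //; rewrite invr_gt0.
have ux : hlim (fun k => orbit_sum B (u k)) x.
  apply: hlim_le (@cvg_harmonic R) => k; rewrite hnormBC; exact/ltW/uP.
apply: (hlim_uniq (hlim_bop S ux)).
by under eq_fun do rewrite SS'; apply: hlim_bop.
Qed.

Lemma intertwiner_uniq B A (L L' : bop (dilation_space B) (dilation_space A)) :
  row_le B 1 -> intertwiner L -> intertwiner L' -> L = L'.
Proof.
move=> B1 LP L'P; apply: dense_bop_eq => // s.
by rewrite !intertwiner_orbit_sum.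
Qed.

Lemma LopE B A (L : bop (dilation_space B) (dilation_space A)) :
  row_le B 1 -> intertwiner L -> Lop B A = L.
Proof.
move=> B1 LP; apply: (intertwiner_uniq B1) => //.
have ex : exists L, [set L : bop (dilation_space B) (dilation_space A) |
  intertwiner L] L by exists L.
exact: (xgetPex 0 ex).
Qed.

(** [L] sends the orbit sum of a list for [B] to that of the same list for [A]. It intertwines
    because [V_i] merely prefixes [i] to each word. *)
Lemma intertwiner_exists B A (c : R) : row_le B 1 -> 0 <= c ->
  (forall s, hnorm (orbit_sum A s) <= c * hnorm (orbit_sum B s)) ->
  exists L : bop (dilation_space B) (dilation_space A), intertwiner L.
Proof.
move=> B1 c0 AB.
pose G (x : dilation_space B) (y : dilation_space A) :=
  exists s, x = orbit_sum B s /\ y = orbit_sum A s.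
have [] := @linear_relation_extension _ _ _ G c c0.
- move=> a _ _ _ _ [s [-> ->]] [t [-> ->]].
  exists ([seq (p.1, a *: p.2) | p <- s] ++ t).
  by rewrite !orbit_sum_cat !orbit_sumZ.
- by move=> _ _ [s [-> ->]].
- move=> x e e0; have [s xs] := @orbit_dense _ _ _ _ B1 x e e0.
  by exists (orbit_sum B s), (orbit_sum A s); split => //; exists s.
move=> L LG _; exists L; split=> [h|i].
  apply: LG; exists [:: ([::], h)].
  by rewrite /orbit_sum !big_seq1.
apply: dense_bop_eq => // s.
rewrite -[LHS]/(L (dilation B i (orbit_sum B s))).
rewrite -[RHS]/(dilation A i (L (orbit_sum B s))).
rewrite (LG (orbit_sum B s) (orbit_sum A s)); last by exists s.
by rewrite -!orbit_sum_dilation; apply: LG; exists [seq (i :: p.1, p.2) | p <- s].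
Qed.

End IntertwinerUnique.

Section QuadraticForm.
Variables (R : realType) (n m : nat) (p : ncpoly R n m).
Variables (H : hilbertType R) (X : 'I_n -> bop H H).

Lemma nceval_dot f : hdot (nceval p X f) f =
  \sum_i \sum_j \sum_(w <- finsupp p) p w i j * hdot (monomial X w (f j)) (f i).
Proof.
apply: eq_bigr => i _; rewrite ffunE hdot_suml; apply: eq_bigr => j _.
by rewrite mxE bop_sumE hdot_suml; apply: eq_bigr => w _; rewrite -hdotZl.
Qed.

End QuadraticForm.

(* The polynomial whose real part is half the Gram matrix of the vectors
   V_(W i) h of the dilation. *)
Section GramPolynomial.
Variables (R : realType) (n m : nat) (W : 'I_m -> seq 'I_n).

(** Equal words are prefixes of each other, so the empty quotient is counted from both sides and
    gets weight one half. *)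
Definition gram_weight (w : seq 'I_n) : R[i] := if nilp w then 2^-1%:C else 1.

Definition gram_coef (w : seq 'I_n) : 'M[R[i]]_m :=
  \matrix_(i, j) if W j == W i ++ w then gram_weight w else 0.

(** The finite domain consists of the suffixes of the words [W j]; [gram_coef] vanishes
    elsewhere. *)
Definition gram_poly : ncpoly R n m :=
  [fsfun w in [fset drop k (W j) | k in iota 0 (\max_j size (W j)).+1,
                                   j in enum 'I_m]%fset => gram_coef w].

Lemma gram_polyE w i j :
  gram_poly w i j = if W j == W i ++ w then gram_weight w else 0.
Proof.
rewrite fsfunE; case: ifPn => [_|]; first by rewrite mxE.
rewrite mxE; case: eqP => // Wj /negP[]; apply/imfset2P.
exists (size (W i)); last exists j.
- rewrite mem_iota /= add0n ltnS; exact: leq_bigmax.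
- by rewrite mem_enum.
- by rewrite Wj drop_size_cat.
Qed.

Variables (H : hilbertType R) (X : 'I_n -> bop H H).

Definition gram_entry (u v : seq 'I_n) (h k : H) : R :=
  if prefix u v then complex.Re (gram_weight (drop (size u) v) *
    hdot (monomial X (drop (size u) v) k) h) else 0.

Lemma gram_poly_sum i j h k :
  complex.Re (\sum_(w <- finsupp gram_poly) gram_poly w i j * hdot (monomial X w k) h)
  = gram_entry (W i) (W j) h k.
Proof.
rewrite /gram_entry; case: prefixP => [[w Ww]|nW].
  rewrite Ww drop_size_cat //.
  have pw : gram_poly w i j = gram_weight w by rewrite gram_polyE Ww eqxx.
  have w0 : gram_weight w != 0.
    rewrite /gram_weight; case: nilp; rewrite ?oner_eq0 //.
    by apply/eqP => /(congr1 (@complex.Re R)) /=; lra.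
  have wS : w \in finsupp gram_poly.
    rewrite mem_finsupp; apply: contraNneq w0 => p0.
    by rewrite -pw p0 mxE.
  rewrite (bigD1_seq w) ?fset_uniq //= pw big1 ?addr0 // => v vw.
  rewrite gram_polyE Ww eqseq_cat // eqxx /= eq_sym (negPf vw) mul0r //.
rewrite big1 // => w _; rewrite gram_polyE; case: eqP => [Ww|_]; last by rewrite mul0r.
by case: nW; exists w.
Qed.

Hypothesis X1 : row_le X 1.

(** Common first letters cancel because the [V_i] are isometries, distinct ones give orthogonal
    vectors; once one word is exhausted, the other compresses to a monomial in [X]. *)
Lemma gram_entryP u v h k :
  complex.Re (hdot (monomial (dilation X) v (k, 0)) (monomial (dilation X) u (h, 0)))
  = gram_entry u v h k + gram_entry v u k h.
Proof.
elim: u v => [|a u IH] [|b v].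
- rewrite /gram_entry /= !ReM /= (hdot_herm h) Re_conj.
  rewrite -[hdot _ _]/(hdot k h + hdot 0 0) hdot0l addr0; lra.
- by rewrite /gram_entry drop0 mul1r addr0 hdot_monomial_inl.
- by rewrite /gram_entry drop0 mul1r add0r hdot_herm Re_conj hdot_monomial_inl.
rewrite [LHS]/= dilation_isometry // /gram_entry /=.
rewrite !(eq_sym b); case: eqP => [_|_] /=; last by rewrite mul0r addr0.
by rewrite mul1r IH.
Qed.

Lemma gram_polyP f : complex.Re (hdot (nceval gram_poly X f) f) =
  2^-1 * sqn (\sum_i monomial (dilation X) (W i) (f i, 0)).
Proof.
rewrite nceval_dot Re_sum.
under eq_bigr do rewrite Re_sum.
under eq_bigr do under eq_bigr do rewrite gram_poly_sum.
rewrite {1}/sqn /sqn_of hdot_sumr Re_sum.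
under [in RHS]eq_bigr do rewrite hdot_suml Re_sum.
under [in RHS]eq_bigr do under eq_bigr do rewrite gram_entryP.
under [in RHS]eq_bigr do rewrite big_split.
rewrite big_split /= [X in _ = _ * (_ + X)]exchange_big /=; lra.
Qed.

End GramPolynomial.

(** Domination is tested on [gram_poly] for the words of [s]. The Gram formula holds for every row
    contraction, hence also shows that this polynomial has positive real part on [K]. *)
Lemma harnack_intertwiner (R : realType) (n : nat) (K H : hilbertType R)
    (A B : 'I_n -> bop H H) : row_le A 1 -> row_le B 1 -> harnack_dom K A B ->
  exists L : bop (dilation_space B) (dilation_space A), intertwiner L.
Proof.
move=> A1 B1 [c c0 AB]; apply: (@intertwiner_exists _ _ _ _ _ c) => // [|s].
  exact: ltW.
rewrite hnorm_le_sqn; last exact: ltW.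
pose W (i : 'I_(size s)) := (nth ([::], 0) s i).1.
have /AB/ople_reopE h : positive_real_part K (gram_poly R W).
  move=> X X1; apply/opsd_reopE => f; rewrite gram_polyP ?mulr_ge0 ?invr_ge0 ?sqn_ge0 //.
  by apply: row_contraction_le; apply: ltW.
pose f := [ffun i : 'I_(size s) => (nth ([::], 0) s i).2].
have E T : \sum_(i < size s) monomial (dilation T) (W i) (f i, 0) = orbit_sum T s.
  rewrite /orbit_sum (big_nth ([::], 0)) big_mkord.
  by apply: eq_bigr => i _; rewrite ffunE.
have := h f; rewrite (gram_polyP W A1) (gram_polyP W B1) !E.
by rewrite mulrCA ler_pM2l ?invr_gt0.
Qed.

(** * Harnack domination from intertwiners *)

Section PartialIsometry.
Variable R : realType.

Section RankOne.
Variables (H K : hilbertType R) (r : H) (f : K).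

Lemma rank_one_subproof : bounded_linear (fun x => hdot x r *: f).
Proof.
apply/bounded_linearP; split=> [a x y|].
  by rewrite hdot_linearl scalerDl scalerA.
exists (2 * (sqn r * sqn f)) => [|x]; first by rewrite !mulr_ge0 ?sqn_ge0.
rewrite sqnZ -mulrA [leRHS]mulrA mulrAC [leRHS](_ : _ = 2 * (sqn x * sqn r) * sqn f);
  last by ring.
rewrite ler_wpM2r ?sqn_ge0 // mulr2n mulrDl mul1r lerD //; first exact: Re_hdot_sqr.
have -> : complex.Im (hdot x r) = - complex.Re (hdot ((0 +i* 1) *: x) r).
  by rewrite hdotZl ReM /=; ring.
rewrite sqrrN; apply: le_trans (Re_hdot_sqr _ _) _.
by rewrite sqnZ /= expr0n expr1n add0r mul1r.
Qed.
Definition rank_one : bop H K := mkbop rank_one_subproof.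

End RankOne.

Lemma adj_rank_one (H K : hilbertType R) (r : H) (f : K) :
  adj (rank_one r f) = rank_one f r.
Proof.
by apply: adj_uniq => x y /=; rewrite hdotZl hdotZr -hdot_herm mulrC.
Qed.

Definition partial_isometry (H K : hilbertType R) (J : bop H K) : Prop :=
  forall x, J (adj J (J x)) = J x.

Lemma partial_isometry_adj (H K : hilbertType R) (J : bop H K) :
  partial_isometry J -> partial_isometry (adj J).
Proof.
move=> JP y; rewrite adjK; apply/eqP; rewrite -subr_eq0; apply/eqP/hdot_eq0 => x.
by rewrite hdotBl -!adjPr adjP -adjPr JP subrr.
Qed.

(** [J J^* J = J] gives [|J^* J x| = |J x|], so [|J x|^2 = Re <x, J^* J x> <= |x| |J x|]. *)
Lemma partial_isometry_le (H K : hilbertType R) (J : bop H K) x :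
  partial_isometry J -> hnorm (J x) <= hnorm x.
Proof.
move=> JP; have e1 : sqn (adj J (J x)) = sqn (J x).
  by rewrite /sqn /sqn_of -adjP JP.
have e2 : sqn (J x) = complex.Re (hdot x (adj J (J x))) by rewrite /sqn /sqn_of adjP.
have := Re_hdot_hnorm x (adj J (J x)); rewrite -e2 {2}/hnorm e1 -/(hnorm (J x)).
rewrite ger0_norm ?sqn_ge0 // -sqr_hnorm expr2.
have [->|Jx0] := eqVneq (hnorm (J x)) 0; first by rewrite hnorm_ge0.
by rewrite ler_pM2r // lt_neqAle eq_sym Jx0 hnorm_ge0.
Qed.

(** Induction on [v], adding a rank-one partial isometry for each new direction. The induction also
    records that the range of [J] lies in a finite span, which leaves room in [K]. *)
Lemma partial_isometry_exists (K H : hilbertType R) (v : seq H) :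
  infinite_dimensional K ->
  exists2 J : bop H K, partial_isometry J & forall x, x \in v -> adj J (J x) = x.
Proof.
move=> Kinf.
suff [J [JP [Jv _]]] : exists J : bop H K, partial_isometry J /\
    (forall x, x \in v -> adj J (J x) = x) /\
    exists (k : nat) (g : nat -> K), forall x, exists c : nat -> R[i],
      J x = \sum_(i < k) c i *: g i by exists J.
elim: v => [|x v [J [JP [Jv [k [g Jg]]]]]].
  exists 0; split; [by move=> x; rewrite linear0|split=> //].
  by exists 0%N, (fun=> 0) => x; exists (fun=> 0); rewrite big_ord0.
have [x0|x0] := eqVneq (x - adj J (J x)) 0.
  exists J; split=> //; split; last by exists k, g.
  move=> y; rewrite inE => /predU1P[->|/Jv//].
  by apply/esym/eqP; rewrite -subr_eq0 x0.
set r := x - adj J (J x) in x0.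
have rE : r = x - adj J (J x) by [].
clearbody r.
have JaP := partial_isometry_adj JP.
have Jr : J r = 0 by rewrite rE linearB /= JP subrr.
(* [f] is the part of [f0] orthogonal to the range of [J]; it is nonzero because [f0] lies outside
   the span of the [g i]. *)
have [f0 f0P] := Kinf k (fun i => g i).
set f := f0 - J (adj J f0).
have f_n0 : f != 0.
  apply/eqP => /eqP; rewrite subr_eq0 => /eqP f0E.
  have [c cE] := Jg (adj J f0); apply: (f0P (fun i => c i)).
  by rewrite {1}f0E cE.
have Jf : adj J f = 0.
  by rewrite linearB /= -{1}[in X in _ - adj J (X _)](adjK J) JaP subrr.
(* This normalisation makes [E] send [r / |r|] to [f / |f|]. *)
pose a := (Num.sqrt (sqn f * sqn r))^-1.
have sf := sqn_gt0 f_n0; have sr := sqn_gt0 x0.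
have a2 : a * a * sqn f * sqn r = 1.
  rewrite -expr2 exprVn sqr_sqrtr ?mulr_ge0 ?ltW //; field.
  by rewrite !gt_eqF.
pose E := rank_one r (a%:C *: f).
have EaE z : adj E z = a%:C * hdot z f *: r.
  rewrite adj_rank_one /= hdotZr; congr (_ * _ *: _).
  by apply: complex_eq; rewrite //= oppr0.
(* [E] and [J] have orthogonal ranges and orthogonal initial spaces, so the cross terms in [J'^* J']
   vanish. *)
have JE z : adj J (E z) = 0 by rewrite !linearZ /= Jf !scaler0.
have EJ z : adj E (J z) = 0.
  by rewrite EaE adjP Jf hdot0r mulr0 scale0r.
have aR : (a * a * sqn f)%:C = (sqn r)%:C^-1 :> R[i].
  apply: (mulIf (x := (sqn r)%:C)); last first.
    rewrite mulVf ?(inj_eq (@complexI R)) ?gt_eqF //.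
    by rewrite -rmorphM /= a2.
  by rewrite (inj_eq (@complexI R)) gt_eqF.
have ER z : adj E (E z) = (hdot z r / (sqn r)%:C) *: r.
  rewrite EaE /= !hdotZl hdotxx -aR; congr (_ *: _).
  by rewrite !rmorphM /=; ring.
have rx z : hdot (adj J z) r = 0 by rewrite -adjPr Jr hdot0r.
pose J' := J + E.
have J'J z : adj J' (J' z) = adj J (J z) + (hdot z r / (sqn r)%:C) *: r.
  rewrite /J' adjD !bop_addE !linearD /= JE EJ ER addr0 add0r //.
exists J'; split; last split.
- move=> z; rewrite J'J /J' !bop_addE; congr (_ + _).
    by rewrite linearD linearZ /= Jr scaler0 addr0 JP.
  rewrite /E /=; congr (_ *: _); rewrite hdotDl rx add0r hdotZl hdotxx divfK //.
  by rewrite (inj_eq (@complexI R)) gt_eqF.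
- move=> y; rewrite inE J'J => /predU1P[->|yv].
    have -> : hdot x r = (sqn r)%:C.
      by rewrite -hdotxx {2}rE hdotBl rx subr0.
    rewrite divff; first by rewrite scale1r rE addrC subrK.
    by rewrite (inj_eq (@complexI R)) gt_eqF.
  by rewrite -{2}(Jv y yv) rx mul0r scale0r addr0 Jv.
exists k.+1, (fun i => if i == k then a%:C *: f else g i) => z.
have [c cE] := Jg z; exists (fun i => if i == k then hdot z r else c i).
rewrite (_ : J' z = J z + E z) // big_ord_recr eqxx cE; congr (_ + _).
by apply: eq_bigr => i _; rewrite /= (ltn_eqF (ltn_ord i)).
Qed.

End PartialIsometry.

Lemma monomialZ (R : realType) (n : nat) (H : hilbertType R)
    (X : 'I_n -> bop H H) (a : R[i]) w x :
  monomial (fun i => a *: X i) w x = a ^+ size w *: monomial X w x.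
Proof.
elim: w => [|i w IH] /=; first by rewrite scale1r.
by rewrite IH -[LHS]/(a *: X i (a ^+ size w *: _)) linearZ scalerA exprS.
Qed.

Section Positivity.
Variables (R : realType) (n m : nat) (p : ncpoly R n m).
Variables (K : hilbertType R).
Hypotheses (Kinf : infinite_dimensional K) (pK : positive_real_part K p).

(* p(X) only sees the finitely many vectors X_w f_j with w a suffix of a word
   of p; a partial isometry J carries them into K. *)
Lemma positive_strict (H : hilbertType R) (X : 'I_n -> bop H H) (r : R) f :
  0 <= r < 1 -> row_le X r -> 0 <= complex.Re (hdot (nceval p X f) f).
Proof.
move=> r01 Xr; have /andP[r0 _] := r01.
pose v := flatten [seq [seq monomial X (drop kj.1 w) (f kj.2) |
  kj <- allpairs pair (iota 0 (size w).+1) (enum 'I_m)] | w <- finsupp p].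
have [J JP Jv] := partial_isometry_exists v Kinf.
have Jsuf u a w j : u \in finsupp p -> u = a ++ w ->
    adj J (J (monomial X w (f j))) = monomial X w (f j).
  move=> up uw; apply: Jv; apply/flattenP.
  exists [seq monomial X (drop kj.1 u) (f kj.2) |
    kj <- allpairs pair (iota 0 (size u).+1) (enum 'I_m)].
    by apply/mapP; exists u.
  apply/mapP; exists (size a, j); last by rewrite /= uw drop_size_cat.
  apply/allpairsP; exists (size a, j); split; rewrite ?mem_enum //.
  by rewrite mem_iota add0n ltnS /= uw size_cat leq_addr.
(* The tuple transported to [K]; its row bound is still [r] because [J] and its adjoint are
   contractions. *)
pose Z i := J \ob X i \ob adj J.
have Zr : row_le Z r.
  move=> u; rewrite (_ : \sum_i _ = J (\sum_i X i (adj J (u i)))); last first.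
    by rewrite linear_sum.
  have le_sqn (H1 H2 : hilbertType R) (S : bop H1 H2) x :
      partial_isometry S -> sqn (S x) <= sqn x.
    move=> SP; have := partial_isometry_le x SP.
    by rewrite -[leRHS]mul1r hnorm_le_sqn // expr1n mul1r.
  apply: le_trans (le_sqn _ _ _ _ JP) _; apply: le_trans (Xr _) _.
  rewrite ler_wpM2l //; apply: ler_sum => i _.
  exact: le_sqn (partial_isometry_adj JP).
have /pK/opsd_reopE/(_ [ffun j => J (f j)]) : strict_row_contraction Z.
  exact: row_le_strict r01 Zr.
rewrite !nceval_dot; congr (_ <= complex.Re _).
apply: eq_bigr => i _; apply: eq_bigr => j _; apply: eq_big_seq => u up.
congr (_ * _); rewrite !ffunE.
have -> : monomial Z u (J (f j)) = J (monomial X u (f j)).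
  (* The prefix [a] keeps [w] a suffix of [u] along the induction, so [J^* J] fixes each
     intermediate vector. *)
  suff h w a : u = a ++ w -> monomial Z w (J (f j)) = J (monomial X w (f j)).
    exact: (h u [::]).
  elim: w a => // l w IH a uw /=.
  by rewrite (IH (rcons a l)) ?cat_rcons // (Jsuf u (rcons a l)) // cat_rcons.
by rewrite adjPr (Jsuf u [::]).
Qed.

(** Apply the strict case to [t_k X] with [t_k = 1 - 1 / (k + 1)] and let [k] grow; [p] is a finite
    sum of monomials, so the form converges term by term. *)
Lemma positive_row_contraction (H : hilbertType R) (X : 'I_n -> bop H H) f :
  row_le X 1 -> 0 <= complex.Re (hdot (nceval p X f) f).
Proof.
move=> X1; pose t k : R := 1 - k.+1%:R^-1.
have t01 k : 0 <= t k < 1.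
  rewrite /t subr_ge0 invf_le1 ?ltr0n // ler1n /=.
  by rewrite ltrBlDr ltrDl invr_gt0.
have t1 : t @ \oo --> (1 : R).
  by rewrite -[X in _ --> X]subr0; apply: cvgB; [exact: cvg_cst|exact: cvg_harmonic].
have tX d : t k ^+ d @[k --> \oo] --> (1 : R).
  elim: d => [|d IH]; first by under eq_fun do rewrite expr0; apply: cvg_cst.
  have c : (t \* (fun k => t k ^+ d)) @ \oo --> (1 * 1 : R) by apply: cvgM.
  rewrite mulr1 (_ : _ \* _ = fun k => t k ^+ d.+1) // in c.
  by apply: funext => k; rewrite exprS.
pose F k := complex.Re (hdot (nceval p (fun i => (t k)%:C *: X i) f) f).
have F0 k : 0 <= F k.
  apply: (@positive_strict _ _ (t k ^+ 2)).
    by have /andP[? ?] := t01 k; rewrite exprn_ge0 // exprn_ilt1.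
  move=> u; rewrite (_ : \sum_i _ = (t k)%:C *: \sum_i X i (u i)).
    rewrite sqnZ /= expr0n addr0 ler_wpM2l ?exprn_ge0 //; first by have /andP[] := t01 k.
    by have := X1 u; rewrite mul1r.
  by rewrite scaler_sumr.
suff Fl : F k @[k --> \oo] --> complex.Re (hdot (nceval p X f) f).
  by apply: (ler_cvg_to (@cvg_cst _ _ _ _ _) Fl); apply: nearW.
rewrite /F nceval_dot Re_sum; under eq_fun do rewrite nceval_dot Re_sum.
apply: cvg_bigsum => i; rewrite Re_sum; under eq_fun do rewrite Re_sum.
apply: cvg_bigsum => j; rewrite Re_sum; under eq_fun do rewrite Re_sum.
apply: cvg_bigsum => w.
have E k : complex.Re (p w i j * hdot (monomial (fun i => (t k)%:C *: X i) w (f j)) (f i))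
    = t k ^+ size w * complex.Re (p w i j * hdot (monomial X w (f j)) (f i)).
  rewrite monomialZ hdotZl -rmorphXn /= mulrCA [LHS]ReM /=.
  by rewrite mul0r subr0.
under eq_fun do rewrite E.
set b := complex.Re _; have c : t k ^+ size w * b @[k --> \oo] --> (1 * b) by apply: cvgMr_tmp.
by rewrite mul1r in c.
Qed.

End Positivity.

Section IntertwinerHarnack.
Variables (R : realType) (n : nat) (H : hilbertType R).
Variables (A B : 'I_n -> bop H H) (A1 : row_le A 1) (B1 : row_le B 1).
Variable L : bop (dilation_space B) (dilation_space A).
Hypothesis LP : intertwiner L.

(* E is the closed range of D, where D^2 = 1 - (L/c)^* (L/c), and W_i maps D x
   to D V_i x. *)
Lemma intertwiner_defect : exists c : R, exists E : hilbertType R,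
  exists d : bop (dilation_space B) E, exists W : 'I_n -> bop E E,
  [/\ 0 < c, row_le W 1, forall i x, W i (d x) = d (dilation B i x) &
      forall x y, hdot (d x) (d y) = hdot x y - (c ^- 2)%:C * hdot (L x) (L y)].
Proof.
have [c c0 Lc] := bop_bound L.
have ci0 : 0 <= c^-1 by rewrite invr_ge0 ltW.
(* Scaling makes [M] a contraction, so [1 - M^* M] has a positive root. *)
pose M := c^-1%:C *: L.
have ME x : M x = c^-1%:C *: L x by [].
have M1 x : hnorm (M x) <= 1 * hnorm x.
  by rewrite mul1r ME hnormZr // mulrC ler_pdivrMr // mulrC.
have M1' y : hnorm (adj M y) <= 1 * hnorm y by apply: adj_bound.
pose Q := adj M \ob M.
have Qdot x y : hdot (Q x) y = hdot (M x) (M y) by rewrite /= -adjPr.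
have Qsa x y : hdot (Q x) y = hdot x (Q y).
  by rewrite (hdot_herm x) !Qdot -hdot_herm.
have Q1 x : hnorm (Q x) <= hnorm x.
  have := M1' (M x); have := M1 x; rewrite !mul1r /=; exact: (fun a b => le_trans b a).
have [D D0 DD] := sqrt_exists Qsa Q1.
have Ddot x y : hdot (D x) (D y) = hdot x y - (c ^- 2)%:C * hdot (L x) (L y).
  rewrite (opsd_selfadj D0) (_ : D (D y) = y - Q y); last first.
    by rewrite -[LHS]/((D \ob D) y) DD.
  rewrite hdotBr -Qsa Qdot !ME hdotZl hdotZr mulrA; congr (_ - _ * _).
  by apply: complex_eq; rewrite ?ReM ?ImM ?Re_conj ?Im_conj /= -?exprVn; ring.
have dP : bounded_linear (to_clran D).
  split=> [a x y|]; first by apply: val_inj; rewrite /= linearP.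
  by have [K' _ DK'] := bop_bound D; exists K' => x; apply: DK'.
pose d : bop (dilation_space B) (clran D) := mkbop dP.
have ddot x y : hdot (d x) (d y) = hdot x y - (c ^- 2)%:C * hdot (L x) (L y).
  exact: Ddot.
have LV i x : L (dilation B i x) = dilation A i (L x).
  by rewrite -[LHS]/((L \ob dilation B i) x) LP.2.
(* Both dilations consist of isometries with orthogonal ranges and [L] intertwines them, so the form
   [<d x, d y>] inherits the same relations. *)
have dV i j x y : hdot (d (dilation B i x)) (d (dilation B j y)) =
    (i == j)%:R * hdot (d x) (d y).
  by rewrite !ddot !LV !dilation_isometry //; ring.
have dense (u : clran D) e : 0 < e -> exists x, hnorm (u - d x) < e.
  by move=> e0; have /asboolP/(_ _ e0)[x ux] := valP u; exists x.
have /boolp.choice[W WP] : forall i, exists W : bop (clran D) (clran D),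
    forall x, W (d x) = d (dilation B i x).
  move=> i; pose G u v := exists x, u = d x /\ v = d (dilation B i x).
  have [|||W WG _] := @linear_relation_extension _ _ _ G 1 ler01.
  - move=> a _ _ _ _ [x [-> ->]] [y [-> ->]]; exists (a *: x + y).
    by rewrite !linearP.
  - move=> _ _ [x [-> ->]]; rewrite mul1r /hnorm /sqn /sqn_of dV eqxx mul1r //.
  - move=> u e /(dense u)[x ux]; exists (d x), (d (dilation B i x)); split=> //.
    by exists x.
  by exists W => x; apply: WG; exists x.
exists c, (clran D), d, W; split=> // u.
(* The row bound, an equality on the range of [d], passes to its closure by continuity. *)
have /boolp.choice[x xP] : forall i, exists x : nat -> dilation_space B,
    hlim (fun k => d (x k)) (u i).
  move=> i; have /boolp.choice[x xP] : forall k : nat, exists x,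
      hnorm (u i - d x) < k.+1%:R^-1.
    by move=> k; apply: dense; rewrite invr_gt0.
  exists x; apply: hlim_le (@cvg_harmonic R) => k; rewrite hnormBC; exact/ltW/xP.
have c1 : hlim (fun k => \sum_i W i (d (x i k))) (\sum_i W i (u i)).
  by apply: hlim_sum => i; apply: hlim_bop.
have c2 : \sum_i sqn (d (x i k)) @[k --> \oo] --> \sum_i sqn (u i).
  by apply: cvg_bigsum => i; apply: hlim_sqn.
rewrite mul1r; apply: (ler_cvg_to (hlim_sqn c1) c2); apply: nearW => k.
rewrite {1}/sqn /sqn_of hdot_suml Re_sum; apply: ler_sum => i _.
rewrite hdot_sumr (bigD1 i) //= big1 ?addr0 => [|j ji]; rewrite !WP dV.
  by rewrite eqxx mul1r.
by rewrite eq_sym (negPf ji) mul0r.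
Qed.

(** On vectors [d (f_j, 0)] the form of [p(W)] equals that of [p(B)] minus [c^-2] times that of
    [p(A)], because [L] fixes [H] and monomials of the dilations compress to those of [B] and
    [A]. *)
Lemma intertwiner_harnack (K : hilbertType R) :
  infinite_dimensional K -> harnack_dom K A B.
Proof.
move=> Kinf; have [c [E [d [W [c0 W1 Wd dd]]]]] := intertwiner_defect.
exists c => // m p pK; apply/ople_reopE => f.
have := positive_row_contraction Kinf pK [ffun j => d (f j, 0)] W1.
have -> : hdot (nceval p W [ffun j => d (f j, 0)]) [ffun j => d (f j, 0)] =
    hdot (nceval p B f) f - (c ^- 2)%:C * hdot (nceval p A f) f.
  rewrite !nceval_dot mulr_sumr -sumrB; apply: eq_bigr => i _.
  rewrite mulr_sumr -sumrB; apply: eq_bigr => j _.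
  rewrite mulr_sumr -sumrB; apply: eq_bigr => w _.
  rewrite !ffunE (_ : monomial W w (d (f j, 0)) = d (monomial (dilation B) w (f j, 0))).
    rewrite dd intertwiner_monomial // !LP.1 !hdot_monomial_inl; ring.
  by elim: w => //= l w ->; rewrite Wd.
rewrite ReD ReN ReM /= mul0r subr0 subr_ge0 mulrC ler_pdivrMr ?exprn_gt0 //.
by rewrite mulrC.
Qed.

End IntertwinerHarnack.

(** * The multi-analytic corner *)

Section LowerTriangular.
Variables (R : realType) (n : nat) (H : hilbertType R).
Implicit Types A B C T : 'I_n -> bop H H.

Lemma intertwiner_id B : intertwiner (bid (dilation_space B)).
Proof. by split=> // i; apply: bop_ext. Qed.

Lemma intertwiner_comp A B C (L : bop (dilation_space B) (dilation_space A))
    (L' : bop (dilation_space C) (dilation_space B)) :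
  intertwiner L -> intertwiner L' -> intertwiner (L \ob L').
Proof.
move=> [LH LV] [L'H L'V]; split=> [h|i]; first by rewrite /= L'H LH.
apply: bop_ext => x; rewrite -[LHS]/(L ((L' \ob dilation C i) x)) L'V.
by rewrite -[LHS]/((L \ob dilation B i) (L' x)) LV.
Qed.

(** [Theta] for an explicit operator [L] instead of the selected [Lop B A]. *)
Definition theta_of A B (L : bop (dilation_space B) (dilation_space A)) :
    bop (fock n (defect_space A)) (fock n (defect_space B)) :=
  snd_op H (fock n (defect_space B)) \ob adj L \ob inr_op H (fock n (defect_space A)).

Section Intertwiner.
Variables (A B : 'I_n -> bop H H) (L : bop (dilation_space B) (dilation_space A)).
Hypothesis LP : intertwiner L.

Lemma adj_intertwiner_fst y : (adj L y).1 = y.1.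
Proof.
apply/eqP; rewrite -subr_eq0; apply/eqP/hdot_eq0 => h.
rewrite hdotBl.
have inlE T (z : dilation_space T) : hdot z.1 h = hdot z (h, 0).
  by rewrite -[RHS]/(hdot z.1 h + hdot z.2 0) hdot0r addr0.
by rewrite !inlE -adjPr LP.1 subrr.
Qed.

Lemma adj_intertwiner_inr xi : adj L (0, xi) = (0, theta_of L xi).
Proof.
rewrite [LHS]surjective_pairing adj_intertwiner_fst.
by [].
Qed.

Lemma adj_dilation_intertwiner i y :
  adj (dilation B i) (adj L y) = adj L (adj (dilation A i) y).
Proof.
rewrite -[LHS]/((adj (dilation B i) \ob adj L) y) -adj_comp LP.2 adj_comp //.
Qed.

End Intertwiner.

Lemma adj_dilationK T i j x : row_le T 1 ->
  adj (dilation T i) (dilation T j x) = (i == j)%:R *: x.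
Proof.
move=> T1; apply/eqP; rewrite -subr_eq0; apply/eqP/hdot_eq0 => y.
rewrite hdotBl -adjPr dilation_isometry // hdotZl (eq_sym j).
by rewrite subrr.
Qed.

(** Such a [z] is orthogonal to [H] and to the range of every [V_i], hence to all orbit sums. The
    operator [rank_one z z] encodes the functional [<., z>], so that density applies to it. *)
Lemma adj_dilation_eq0 T (z : dilation_space T) : row_le T 1 ->
  z.1 = 0 -> (forall i, adj (dilation T i) z = 0) -> z = 0.
Proof.
move=> T1 z1 zV; have : rank_one z z = 0.
  apply: dense_bop_eq => // s; rewrite /= (_ : hdot _ z = 0) ?scale0r //.
  rewrite /orbit_sum hdot_suml big1 // => -[[|i w] h] _.
    by rewrite -[LHS]/(hdot h z.1 + hdot 0 z.2) z1 hdot0l hdot0r addr0.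
  rewrite -[LHS]/(hdot (dilation T i (monomial (dilation T) w (h, 0))) z).
  by rewrite adjP zV hdot0r.
move=> /(congr1 (fun S : bop _ _ => S z)) /= /eqP.
rewrite scaler_eq0 => /orP[/eqP z0|/eqP//].
by apply: sqn_eq0; rewrite /sqn /sqn_of z0.
Qed.

(** On [(0, xi)] the vectors [L^* V_i] and [V_i L^*] have zero component in [H], and every [V_j^*]
    sends both to [delta_ji L^* (0, xi)]; hence they agree. *)
Lemma theta_multi_analytic A B (L : bop (dilation_space B) (dilation_space A)) :
  row_le A 1 -> row_le B 1 -> intertwiner L -> multi_analytic (theta_of L).
Proof.
move=> A1 B1 LP i; apply: bop_ext => xi.
suff : adj L (dilation A i (0, xi)) = dilation B i (adj L (0, xi)).
  rewrite !(dilation_inr, adj_intertwiner_inr LP).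
  by move=> /(congr1 snd).
apply/eqP; rewrite -subr_eq0; apply/eqP; apply: adj_dilation_eq0 => // [|j].
  set u := adj L _; set v := dilation B i _.
  rewrite -[LHS]/(u.1 - v.1) /u /v adj_intertwiner_fst // adj_intertwiner_inr //.
  by rewrite !dilation_inr subrr.
have E1 : adj (dilation B j) (adj L (dilation A i (0, xi))) =
    (j == i)%:R *: adj L (0, xi).
  by rewrite adj_dilation_intertwiner // adj_dilationK // linearZ.
have E2 := adj_dilationK j i (adj L (0, xi)) B1.
apply: etrans (linearB _ _ _) _; apply/eqP; rewrite subr_eq0; apply/eqP.
exact: etrans E1 (esym E2).
Qed.

(** Adjoints reverse the composition, and corners of lower triangular matrices multiply. *)
Lemma theta_comp A B C (L : bop (dilation_space B) (dilation_space A))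
    (L' : bop (dilation_space C) (dilation_space B)) :
  intertwiner L -> theta_of (L \ob L') = theta_of L' \ob theta_of L.
Proof.
move=> LP; apply: bop_ext => xi; rewrite /theta_of adj_comp.
rewrite -[LHS]/((adj L' (adj L (0, xi))).2) adj_intertwiner_inr //.
Qed.

Lemma theta_id B : theta_of (bid (dilation_space B)) = bid _.
Proof. by apply: bop_ext => xi; rewrite /theta_of adj_id. Qed.

Lemma inl_fst_subproof (F F' : hilbertType R) :
  bounded_linear (fun x : H * F => (x.1, 0) : H * F').
Proof.
apply/bounded_linearP; split=> [a x y|].
  by congr pair; rewrite /= scaler0 addr0.
exists 1 => // x; rewrite mul1r [leLHS]sqn_pair [leRHS]sqn_pair /= sqn0 addr0.
by rewrite lerDl sqn_ge0.
Qed.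
Definition inl_fst (F F' : hilbertType R) : bop (H * F)%type (H * F')%type :=
  mkbop (inl_fst_subproof F F').

(** A triangular [L^*] with corners [I] and an invertible [Theta] is invertible, hence so is [L];
    the inverse of an intertwiner is an intertwiner. *)
Lemma theta_invertible A B (L : bop (dilation_space B) (dilation_space A)) :
  intertwiner L -> invertible (theta_of L) ->
  exists L' : bop (dilation_space A) (dilation_space B), intertwiner L'.
Proof.
move=> LP [T [T1 T2]].
have TK xi : T (theta_of L xi) = xi by rewrite -[LHS]/((T \ob theta_of L) xi) T1.
have KT xi : theta_of L (T xi) = xi by rewrite -[LHS]/((theta_of L \ob T) xi) T2.
pose FA := fock n (defect_space A); pose FB := fock n (defect_space B).
(* The inverse of [L^*]: the lower triangular matrix with diagonal [I], [Theta^-1] and lower left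
   entry [- Theta^-1 Omega], where [Omega h = (adj L (h, 0)).2]. *)
pose P : bop (dilation_space B) (dilation_space A) :=
  inl_fst FB FA + inr_op H FA \ob T \ob
   (snd_op H FB - snd_op H FB \ob adj L \ob inl_fst FB FA).
have PE x : P x = (x.1, T (x.2 - (adj L (x.1, 0)).2)).
  rewrite -[LHS]/((x.1 + 0, 0 + T (x.2 - (adj L (x.1, 0)).2))).
  by rewrite addr0 add0r.
have LE y : adj L y = (y.1, (adj L (y.1, 0)).2 + theta_of L y.2).
  have {1}-> : y = (y.1, 0) + (0, y.2).
    by rewrite {1}(surjective_pairing y); congr pair; rewrite ?addr0 ?add0r.
  rewrite linearD /= adj_intertwiner_inr // {1}[adj L _]surjective_pairing.
  by rewrite adj_intertwiner_fst //; congr pair; rewrite addr0.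
have LPid : adj L \ob P = bid _.
  apply: bop_ext => x; rewrite -[LHS]/(adj L (P x)) PE LE.
  rewrite -[LHS]/(x.1, (adj L (x.1, 0)).2 + theta_of L (T (x.2 - (adj L (x.1, 0)).2))).
  by rewrite KT addrC subrK -surjective_pairing.
have PLid : P \ob adj L = bid _.
  apply: bop_ext => y; rewrite -[LHS]/(P (adj L y)) LE PE.
  rewrite -[LHS]/(y.1, T ((adj L (y.1, 0)).2 + theta_of L y.2 - (adj L (y.1, 0)).2)).
  by rewrite addrAC subrr add0r TK -surjective_pairing.
have {LPid} PLK x : adj P (L x) = x.
  by rewrite -{1}(adjK L) -[LHS]/((adj P \ob adj (adj L)) x) -adj_comp LPid adj_id.
have {PLid} LPK y : L (adj P y) = y.
  by rewrite -{1}(adjK L) -[LHS]/((adj (adj L) \ob adj P) y) -adj_comp PLid adj_id.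
exists (adj P); split=> [h|i]; first by rewrite -{1}LP.1 PLK.
apply: bop_ext => y.
rewrite -[LHS]/(adj P (dilation A i y)) -[RHS]/(dilation B i (adj P y)).
rewrite -{1}(LPK y) -[dilation A i _]/((dilation A i \ob L) (adj P y)) -LP.2.
exact: PLK.
Qed.

End LowerTriangular.

(** * Transitivity of domination and equivalence through the corner *)

Theorem corollary5p2 (R : realType) (n : nat) (n_gt0 : (0 < n)%N)
    (K : hilbertType R) (K_inf : infinite_dimensional K)
    (H : hilbertType R) (A B C : 'I_n -> bop H H)
    (hA : row_contraction A) (hB : row_contraction B) (hC : row_contraction C) :
  (harnack_dom K A B -> harnack_dom K B C ->
     [/\ harnack_dom K A C,
         adj (Lop C A) = adj (Lop C B) \ob adj (Lop B A) &
         Theta C A = Theta C B \ob Theta B A]) /\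
  (harnack_dom K A B ->
     (harnack_equiv K A B <->
        multi_analytic (Theta B A) /\ invertible (Theta B A)) /\
     (harnack_equiv K A B -> inverse_ops (Theta B A) (Theta A B))).
Proof.
have A1 := row_contraction_le hA; have B1 := row_contraction_le hB.
have C1 := row_contraction_le hC.
split=> [AB BC|AB].
  have [L LP] := harnack_intertwiner A1 B1 AB.
  have [L' L'P] := harnack_intertwiner B1 C1 BC.
  have LL'P := intertwiner_comp LP L'P.
  split; first exact: (intertwiner_harnack A1 C1 LL'P K_inf).
    by rewrite (LopE C1 LL'P) (LopE C1 L'P) (LopE B1 LP) adj_comp.
  rewrite -[Theta C A]/(theta_of (Lop C A)) -[Theta C B]/(theta_of (Lop C B)).
  rewrite -[Theta B A]/(theta_of (Lop B A)).
  by rewrite (LopE C1 LL'P) (LopE C1 L'P) (LopE B1 LP) theta_comp.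
have [L LP] := harnack_intertwiner A1 B1 AB.
have ThetaE : Theta B A = theta_of L by rewrite -(LopE B1 LP).
have inv : harnack_equiv K A B -> inverse_ops (Theta B A) (Theta A B).
  move=> [_ BA]; have [L' L'P] := harnack_intertwiner B1 A1 BA.
  rewrite ThetaE (_ : Theta A B = theta_of L'); last by rewrite -(LopE A1 L'P).
  split.
    rewrite -(theta_comp L' LP).
    (* The composite and the identity both intertwine the dilation of [A] with itself, so uniqueness
       identifies them. *)
    rewrite (intertwiner_uniq A1 (intertwiner_comp LP L'P) (intertwiner_id A)).
    exact: theta_id.
  rewrite -(theta_comp L L'P).
  rewrite (intertwiner_uniq B1 (intertwiner_comp L'P LP) (intertwiner_id B)).
  exact: theta_id.
split; last exact: inv.
split=> [AeB|[_]].
  split; first by rewrite ThetaE; apply: theta_multi_analytic.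
  by exists (Theta A B); apply: inv.
rewrite ThetaE => ti; have [L' L'P] := theta_invertible LP ti.
exact: conj AB (intertwiner_harnack B1 A1 L'P K_inf).
Qed.
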